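(* The defining ideal $\mathcal{K}=\ker\Pi_{\mathcal F}$ of the special fiber ring of a rational normal scroll is minimally generated by the polynomials $P_{\alpha,\beta,\gamma,\delta}$ with $(\alpha,\beta,\gamma,\delta)\in\binom{[c]}{4}$ and $Q_{\alpha,\beta,\gamma,\delta}$ with $(\alpha,\beta,\gamma,\delta)\in\binom{[c-d]}{4}$, and these polynomials form a squarefree quadratic Gröbner basis of $\mathcal{K}$ (i.e. a Gröbner basis of quadrics with squarefree leading monomials) with respect to the term order $\prec$.
   Context: Let $\mathbb{K}$ be an arbitrary field, $d\ge1$, $1\le n_1\le\cdots\le n_d$ integers, $c=\sum_i n_i$. Write $[n]=\{1,\ldots,n\}$ and $\binom{\Gamma}{k}$ for the set of strictly increasing $k$-tuples of elements of $\Gamma$. Let $R=\mathbb{K}[x_{i,j}\mid 1\le i\le d,\ 0\le j\le n_i]$. Matrix $\mathbf{M}$: the $2\times c$ matrix whose columns are $\binom{x_{i,j}}{x_{i,j+1}}$ for $1\le i\le d$, $0\le j\le n_i-1$, in the following order. The first $c-d$ columns are those with $j\le n_i-2$, ordered by increasing $j$ and, for equal $j$, by increasing $i$. The last $d$ columns are those with $j=n_i-1$, ordered by decreasing $i$. Its entries are $\mu_{i,j}$, and $g_{\alpha,\beta}=\mu_{1,\alpha}\mu_{2,\beta}-\mu_{1,\beta}\mu_{2,\alpha}$, $\mathbf{g}=\{g_{\alpha,\beta}\mid(\alpha,\beta)\in\binom{[c]}{2}\}$. The ideal $(\mathbf{g})$ is the ideal of the rational normal scroll $\mathcal{S}_{n_1,\ldots,n_d}\subseteq\mathbb{P}^{c+d-1}$.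 For $\alpha\in[c-d]$, if the $\alpha$-th column of $\mathbf{M}$ is $\binom{x_{i,j}}{x_{i,j+1}}$, then $\overline{\alpha}\in[c]$ is the index of the column $\binom{x_{i,j+1}}{x_{i,j+2}}$. Presentation: $S_{\mathcal F}=\mathbb{K}[T_{\alpha,\beta}\mid(\alpha,\beta)\in\binom{[c]}{2}]$ and $\Pi_{\mathcal F}:S_{\mathcal F}\to\mathbb{K}[\mathbf{g}]\subseteq R$, $T_{\alpha,\beta}\mapsto g_{\alpha,\beta}$. Conventions: $T_{\alpha,\beta}=-T_{\beta,\alpha}$ if $\alpha>\beta$, and $T_{\alpha,\alpha}=0$. Define $$P_{\alpha,\beta,\gamma,\delta}=T_{\alpha,\beta}T_{\gamma,\delta}-T_{\alpha,\gamma}T_{\beta,\delta}+T_{\alpha,\delta}T_{\beta,\gamma},$$ $$Q_{\alpha,\beta,\gamma,\delta}=T_{\alpha,\beta}T_{\overline{\gamma},\overline{\delta}}-T_{\alpha,\gamma}T_{\overline{\beta},\overline{\delta}}+T_{\alpha,\delta}T_{\overline{\beta},\overline{\gamma}}+T_{\beta,\gamma}T_{\overline{\alpha},\overline{\delta}}-T_{\beta,\delta}T_{\overline{\alpha},\overline{\gamma}}+T_{\gamma,\delta}T_{\overline{\alpha},\overline{\beta}}.$$ Term order $\prec$ on $S_{\mathcal F}$: for $\alpha<\beta$ set $\mathrm{mdeg}(T_{\alpha,\beta})=\mathbf{e}_{\alpha+d}+\mathbf{e}_{\beta+d}\in\mathbb{N}^{c+d}$ and $\mathrm{sdeg}(T_{\alpha,\beta})=c-\alpha$,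 both extended additively to monomials; $\mathbb{N}^{c+d}$ is ordered lexicographically with $\mathbf{e}_1>\cdots>\mathbf{e}_{c+d}$. Two monomials are compared first by $\mathrm{mdeg}$ (larger is larger), then by $\mathrm{sdeg}$ (larger is larger), then by the lexicographic order induced by $T_{\alpha,\beta}\succ T_{\gamma,\delta}$ if $\alpha<\gamma$, or $\alpha=\gamma$ and $\beta<\delta$. *)

(* Defs.v *)
From HB Require Import structures.
From mathcomp Require Import all_boot all_order all_algebra.
From mathcomp Require Import mpoly.
From mathcomp Require Import zify.

Set Implicit Arguments.
Unset Strict Implicit.
Unset Printing Implicit Defensive.

Import GRing.Theory.
Local Open Scope ring_scope.

(* All indices are 0-based: i : 'I_d stands for the index i + 1 of n_1..n_d,
   and a : 'I_c for the element a + 1 of [c].  The index j of x_(i,j) starts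
   at 0 on paper and is unchanged. *)

Section Ideals.

Variable R : comNzRingType.

Definition ideal_gen (G : R -> Prop) (f : R) : Prop :=
  exists2 s : seq (R * R),
    (forall p, p \in s -> G p.2) & f = \sum_(p <- s) p.1 * p.2.

Definition family_pred (J : Type) (F : J -> R) (f : R) : Prop :=
  exists j, f = F j.

(* No member of the family is redundant; in particular the family is
   injective. *)
Definition minimally_generates (J : eqType) (F : J -> R) (I : R -> Prop) :=
  (forall f, ideal_gen (family_pred F) f <-> I f) /\
  (forall j, ~ ideal_gen (fun f => exists2 i, i != j & f = F i) (F j)).

End Ideals.

Section Groebner.

Variables (K : fieldType) (N : nat) (lt : rel 'X_{1..N}).

Record term_order : Prop := TermOrder {
  term_order_irr : irreflexive lt;
  term_order_trans : transitive lt;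
  term_order_total : forall m m', m != m' -> lt m m' || lt m' m;
  term_order_add : forall m1 m2 m, lt m1 m2 -> lt (m1 + m)%MM (m2 + m)%MM;
  term_order_min : forall m, m != 0%MM -> lt 0%MM m }.

Definition is_lead (f : {mpoly K[N]}) (m : 'X_{1..N}) : Prop :=
  m \in msupp f /\ (forall m', m' \in msupp f -> m' != m -> lt m' m).

Definition initial_ideal (G : {mpoly K[N]} -> Prop) : {mpoly K[N]} -> Prop :=
  ideal_gen (fun h => exists f m, [/\ G f, is_lead f m & h = 'X_[m]]).

Definition groebner_basis (G I : {mpoly K[N]} -> Prop) : Prop :=
  [/\ term_order,
      forall f, G f -> I f
    & forall h, initial_ideal G h <-> initial_ideal I h].

Definition squarefree_mon (m : 'X_{1..N}) : Prop := forall i, (m i <= 1)%N.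

Definition squarefree_quadratic_groebner_basis (G I : {mpoly K[N]} -> Prop) :=
  groebner_basis G I /\
  (forall f, G f ->
     f \is 2.-homog /\ (exists2 m, is_lead f m & squarefree_mon m)).

End Groebner.

(* The set binom([m], k) of strictly increasing k-tuples. *)
Notation incr k m :=
  {t : k.-tuple 'I_m | sorted ltn [seq nat_of_ord i | i <- t]}.

Section Scroll.

Variables (d : nat) (n : 'I_d -> nat).

Definition scroll_c : nat := (\sum_(i < d) n i)%N.

Local Notation c := scroll_c.

(* The pairs (i, j) such that (x_(i,j), x_(i,j+1)) is a column of M, in the
   order of the columns. *)
Definition scroll_columns : seq ('I_d * nat) :=
  flatten [seq [seq (i, j) | i <- enum 'I_d & (j.+2 <= n i)%N] | j <- iota 0 c]
  ++ [seq (i, (n i).-1) | i <- rev (enum 'I_d)].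

Definition scroll_shift (p : 'I_d * nat) : 'I_d * nat := (p.1, p.2.+1).

Definition widen_col (a : 'I_(c - d)) : 'I_c := widen_ord (leq_subr d c) a.

(* The defaults of [nth] and [insubd] are never reached when all n_i are
   positive, see [overlineP] below. *)
Definition overline (a : 'I_(c - d)) : 'I_c :=
  insubd (widen_col a)
    (nth 0%N [seq index (scroll_shift p) scroll_columns | p <- scroll_columns]
       a).

Fact mem_scroll_columns (p : 'I_d * nat) :
  (forall i, (0 < n i)%N) -> (p \in scroll_columns) = (p.2 < n p.1)%N.
Proof.
case: p => i j n_gt0; rewrite mem_cat /=; apply/orP/idP => [[]|lt_j].
- case/flattenP => s /mapP[k _ ->] /mapP[i' + [-> ->]].
  by rewrite mem_filter => /andP[/ltnW].
- by case/mapP => i' _ [-> ->]; rewrite prednK.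
have [lt_j1|le_j1] := ltnP j.+1 (n i); [left | right].
  apply/flattenP; exists [seq (i', j) | i' <- enum 'I_d & (j.+2 <= n i')%N].
    apply/mapP; exists j => //; rewrite mem_iota add0n /=.
    by rewrite /c (bigD1 i) //= (leq_trans lt_j) // leq_addr.
  by apply/mapP; exists i => //; rewrite mem_filter lt_j1 mem_enum.
apply/mapP; exists i; first by rewrite mem_rev mem_enum.
by congr (_, _); apply/eqP; rewrite -eqSS prednK // eqn_leq lt_j le_j1.
Qed.

Fact size_scroll_columns :
  (forall i, (0 < n i)%N) -> size scroll_columns = c.
Proof.
move=> n_gt0.
have sum_lt k m : (\sum_(0 <= j < m) (j < k) = minn k m)%N.
  elim: m => [|m IHm]; first by rewrite big_geq ?minn0.
  by rewrite big_nat_recr //= IHm; case: ltnP => ?; lia.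
rewrite size_cat size_flatten /shape -map_comp size_map size_rev size_enum_ord.
rewrite sumnE big_map.
under eq_bigr => j _.
  rewrite /= size_map size_filter -sumn_count sumnE big_map big_enum /=; over.
rewrite exchange_big /= -[X in (_ + X)%N](card_ord d) -sum1_card -big_split /=.
apply: eq_bigr => i _.
have -> : iota 0 c = index_iota 0 c by rewrite /index_iota subn0.
under eq_bigr => j _ do rewrite -ltn_predRL.
rewrite sum_lt; have : (n i <= c)%N by rewrite /c (bigD1 i) //= leq_addr.
by have := n_gt0 i; lia.
Qed.

(* Column [overline a] of M is the column following column a in its block. *)
Fact overlineP (a : 'I_(c - d)) (p : 'I_d * nat) :
  (forall i, (0 < n i)%N) ->
  nth p scroll_columns (overline a) = scroll_shift (nth p scroll_columns a).
Proof.
move=> n_gt0; have sz := size_scroll_columns n_gt0.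
have lt_a : (a < size scroll_columns)%N by rewrite sz; have := ltn_ord a; lia.
have in_col : scroll_shift (nth p scroll_columns a) \in scroll_columns.
  rewrite mem_scroll_columns //=; move: sz; rewrite {2}/scroll_columns.
  rewrite nth_cat size_cat; set s := flatten _.
  rewrite size_map size_rev size_enum_ord => sz.
  have lt_as : (a < size s)%N by have := ltn_ord a; lia.
  rewrite lt_as; have /flattenP[t /mapP[k _ ->]] := mem_nth p lt_as.
  by case/mapP => i + ->; rewrite mem_filter => /andP[].
rewrite /overline (nth_map p) // val_insubd -{2}sz index_mem in_col.
exact: nth_index.
Qed.

(* Enumeration of the variables x_(i,j), 0 <= j <= n_i, of R. *)
Local Notation x_index := {i : 'I_d & 'I_(n i).+1}.

(* Enumeration of the variables T_(a,b), a < b, of S_F. *)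
Definition fiber_nvars : nat := #|{: incr 2 c}|.

Definition fst_idx (p : incr 2 c) : 'I_c := tnth (val p) ord0.
Definition snd_idx (p : incr 2 c) : 'I_c := tnth (val p) ord_max.

Section Fiber.

Variable K : fieldType.

Local Notation R := {mpoly K[#|{: x_index}|]}.
Local Notation S := {mpoly K[fiber_nvars]}.

(* Only used for j <= n_i, where [inord j] has value j. *)
Definition x_var (i : 'I_d) (j : nat) : R :=
  'X_(enum_rank (Tagged (fun i => 'I_(n i).+1) (inord j : 'I_(n i).+1))).

Definition scroll_matrix : 'M[R]_(2, c) :=
  \matrix_(r < 2, a < c) nth 0 [seq x_var p.1 (p.2 + r) | p <- scroll_columns] a.

Definition g_minor (a b : 'I_c) : R :=
  scroll_matrix ord0 a * scroll_matrix ord_max b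
  - scroll_matrix ord0 b * scroll_matrix ord_max a.

Definition fiber_Pi (f : S) : R :=
  f \mPo [tuple g_minor (fst_idx (enum_val i)) (snd_idx (enum_val i))
         | i < fiber_nvars].

Definition fiber_ideal (f : S) : Prop := fiber_Pi f = 0.

(* The variable T_(a,b) if a < b, and 0 otherwise. *)
Definition T_lt (a b : 'I_c) : S :=
  if insub [tuple a; b] is Some p then 'X_(enum_rank (p : incr 2 c)) else 0.

(* T_(a,b) with the conventions T_(a,b) = - T_(b,a) and T_(a,a) = 0: at most one
   of the two terms is nonzero. *)
Definition T_var (a b : 'I_c) : S := T_lt a b - T_lt b a.

Definition P_poly (a b g e : 'I_c) : S :=
  T_var a b * T_var g e - T_var a g * T_var b e + T_var a e * T_var b g.

Definition Q_poly (a b g e : 'I_(c - d)) : S :=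
  let T a b := T_var (widen_col a) (widen_col b) in
  let T' a b := T_var (overline a) (overline b) in
  T a b * T' g e - T a g * T' b e + T a e * T' b g
  + T b g * T' a e - T b e * T' a g + T g e * T' a b.

Definition fiber_gens (t : incr 4 c + incr 4 (c - d)) : S :=
  match t with
  | inl u => P_poly (tnth (val u) 0) (tnth (val u) 1)
                    (tnth (val u) 2) (tnth (val u) 3)
  | inr u => Q_poly (tnth (val u) 0) (tnth (val u) 1)
                    (tnth (val u) 2) (tnth (val u) 3)
  end.

End Fiber.

(* Strict lexicographic order on I -> nat, [before] being the relation "comes
   strictly earlier" on the positions. *)
Definition lex_lt (I : finType) (before : rel I) (u v : I -> nat) : bool :=
  [exists i, (u i < v i)%N && [forall j, before j i ==> (u j == v j)]].

Local Notation mon := 'X_{1..fiber_nvars}.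

(* The position k : 'I_(c + d) stands for e_(k+1); the two shifts by one cancel
   in e_(alpha + d). *)
Definition fiber_mdeg (m : mon) (k : 'I_(c + d)) : nat :=
  (\sum_(p : incr 2 c) m (enum_rank p) *
     ((k == fst_idx p + d :> nat) + (k == snd_idx p + d :> nat)))%N.

(* The paper's c - alpha is c - (a + 1) for the 0-based index a. *)
Definition fiber_sdeg (m : mon) : nat :=
  (\sum_(p : incr 2 c) m (enum_rank p) * (c - (fst_idx p).+1))%N.

Definition T_before (p q : incr 2 c) : bool :=
  (fst_idx p < fst_idx q)%N
  || (fst_idx p == fst_idx q) && (snd_idx p < snd_idx q)%N.

Definition fiber_lt (m m' : mon) : bool :=
  lex_lt (fun k l : 'I_(c + d) => k < l)%N (fiber_mdeg m) (fiber_mdeg m')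
  || [forall k, fiber_mdeg m k == fiber_mdeg m' k] &&
     ((fiber_sdeg m < fiber_sdeg m')%N
      || (fiber_sdeg m == fiber_sdeg m') &&
         lex_lt T_before (fun p => m (enum_rank p)) (fun p => m' (enum_rank p))).

End Scroll.

Arguments fiber_gens {d} n K t.
Arguments fiber_ideal {d} n K f.
Arguments fiber_lt {d} n m m'.

(* Main.v *)
Require Import Defs.
From mathcomp Require Import all_boot all_order all_algebra.
From mathcomp Require Import mpoly.
From mathcomp Require Import zify ring.

(** Why the theorem is true.

    The polynomials [P] are the Pluecker relations.  The polynomial [Q] is the
    Laplace expansion of a maximal minor of the matrix with four rows whose
    columns stack the column [a] of the scroll matrix over the column
    [overline a]; the second and third rows of that matrix are equal, so [Q]
    vanishes on the scroll.  The leading monomials are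
    [T_(a,g) T_(b,e)] for [P_(a,b,g,e)] and
    [T_(a,b) T_(overline g, overline e)] for [Q_(a,b,g,e)] (lemmas [P_lead] and
    [Q_lead]).  Regard [T_(a,b)] as an arc from [a] to [b].  A monomial divisible
    by none of these leading monomials, a standard monomial, is then a
    noncrossing system of arcs in which no arc [(overline g, overline e)] has
    both [g] and [e] beyond the right end of another arc.

    By the division algorithm ([monomial_reduces]) standard monomials span the
    fiber ring, and everything follows once their images in [R] are known to be
    linearly independent ([standard_independent]): a leading monomial of an
    element of the ideal cannot be standard ([lead_not_standard]), and the
    generators span the ideal.  Minimality is formal, since the generators are
    forms of one degree with distinct leading monomials
    ([irredundant_of_distinct_leads]).

    Independence does not come from one monomial order on [R]: the minors need
    not be a Sagbi basis.  Under the first comparison of the term order the ideal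
    degenerates to a reducible one, with a component for each cut [B] in the
    columns: the matrices whose columns before [B] are proportional to each
    other, and whose columns [overline a] for [a] beyond [B] are too.
    Each component is reached by one choice of weights for the variables of [R],
    for which the bottom entries of the former columns and the top entries of
    the latter are negligible ([top_weight], [bot_weight]).  The weights of the
    columns are the same for all [B], so that in a linear relation between
    standard monomials one can look at the terms of largest column weight, take
    for [B] the least right end of an arc of one of them ([standard_allowed]),
    and keep the monomials that survive on the component [B].

    It remains to separate the surviving monomials.  A perturbation of the
    weights, chosen according to a suitable order of the columns, makes one
    product of two variables the leading monomial of each surviving minor; it
    turns the arc into an opener and a closer.  The columns [overline a] with [a]
    beyond [B] form an interval ([next_convex]), which is what makes such an
    order exist.  The leading monomial of a product of minors determines the
    openers and closers of the arcs ([mon_lead_closers], [mon_lead_openers]),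
    and a noncrossing system of arcs is determined by its openers and closers
    ([noncrossing_matching_unique]). *)

Set Implicit Arguments.
Unset Strict Implicit.
Unset Printing Implicit Defensive.

Import GRing.Theory.
Local Open Scope ring_scope.

(** * Ideals and Groebner bases *)

Section IdealGen.

Variables (R : comNzRingType) (G : R -> Prop).

Lemma ideal_gen0 : ideal_gen G 0.
Proof. by exists [::]; rewrite ?big_nil. Qed.

Lemma ideal_genD f g : ideal_gen G f -> ideal_gen G g -> ideal_gen G (f + g).
Proof.
move=> [s Gs ->] [t Gt ->]; exists (s ++ t); last by rewrite big_cat.
by move=> p; rewrite mem_cat => /orP[/Gs|/Gt].
Qed.

Lemma ideal_genMl h f : ideal_gen G f -> ideal_gen G (h * f).
Proof.
move=> [s Gs ->]; exists [seq (h * p.1, p.2) | p <- s].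
  by move=> _ /mapP[p /Gs Gp ->].
by rewrite big_map big_distrr /=; apply: eq_bigr => p _; rewrite mulrA.
Qed.

Lemma mem_ideal_gen f : G f -> ideal_gen G f.
Proof.
move=> Gf; exists [:: (1, f)]; last by rewrite big_seq1 mul1r.
by move=> p /[!inE] /eqP->.
Qed.

Lemma ideal_gen_sub (I : R -> Prop) :
  I 0 -> (forall f g, I f -> I g -> I (f + g)) ->
  (forall h f, I f -> I (h * f)) -> (forall f, G f -> I f) ->
  forall f, ideal_gen G f -> I f.
Proof.
move=> I0 ID IM GI f [s Gs ->]; elim: s Gs => [|p s IHs] Gs.
  by rewrite big_nil.
rewrite big_cons; apply: ID; first by apply/IM/GI/Gs; rewrite inE eqxx.
by apply: IHs => q qs; apply: Gs; rewrite inE qs orbT.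
Qed.

(** A list of multiples may name the same member several times; degree
    arguments need a single coefficient for each member. *)
Lemma ideal_gen_family (J : finType) (P : pred J) (F : J -> R) f :
  ideal_gen (fun f => exists2 i, P i & f = F i) f ->
  exists H : J -> R, f = \sum_(i | P i) H i * F i.
Proof.
case=> s + ->; elim: s => [|p s IHs] Gs.
  exists (fun=> 0); rewrite big_nil big1 // => i _; exact: mul0r.
have [|H defH] := IHs; first by move=> q qs; apply: Gs; rewrite inE qs orbT.
have [|i Pi defp] := Gs p; first by rewrite inE eqxx.
exists (fun k => (k == i)%:R * p.1 + H k).
rewrite big_cons defH defp; under [RHS]eq_bigr do rewrite mulrDl.
rewrite big_split /=; congr (_ + _).
rewrite (bigD1 i) //= eqxx mul1r big1 ?addr0 // => k /andP[_ /negPf->].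
by rewrite !mul0r.
Qed.

End IdealGen.

Section LeadingMonomials.

Variables (K : fieldType) (N : nat) (lt : rel 'X_{1..N}).
Hypothesis ltO : term_order lt.

Lemma lead_coeff_neq0 (f : {mpoly K[N]}) m : is_lead lt f m -> f@_m != 0.
Proof. by case; rewrite mcoeff_msupp. Qed.

(** Dividing [f] by its leading coefficient makes the coefficient of [X^m]
    cancel; translation by [m - l] keeps all other monomials of [f] smaller. *)
Lemma reduction_step (f : {mpoly K[N]}) l m :
    is_lead lt f l -> (l <= m)%MM ->
  forall m',
    m' \in msupp ('X_[m] - (f@_l)^-1 *: ('X_[(m - l)%MM] * f)) ->
  lt m' m /\ exists2 k, k \in msupp f & m' = (m - l + k)%MM.
Proof.
move=> lead_l le_lm m' m'p; have f_l := lead_coeff_neq0 lead_l.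
have coefM : ('X_[m - l] * f)@_m = f@_l.
  by have := mcoeffMX f (m - l)%MM l; rewrite submK // mulrC.
have neq_m'm : m' != m.
  apply: contraTneq m'p => ->; rewrite mcoeff_msupp negbK.
  by rewrite mcoeffB mcoeffX eqxx mcoeffZ coefM mulVf ?subrr.
have [k kf def_m'] : exists2 k, k \in msupp f & m' = (m - l + k)%MM.
  move: m'p; rewrite mcoeff_msupp mcoeffB mcoeffX [m == _]eq_sym (negPf neq_m'm) sub0r.
  rewrite oppr_eq0 mcoeffZ mulf_eq0 negb_or => /andP[_].
  rewrite -mcoeff_msupp mulrC (perm_mem (msuppMX _ _)) => /mapP[k kf ->].
  by exists k.
split; last by exists k.
rewrite def_m' -[X in lt _ X](submK le_lm) ![(m - l + _)%MM]addmC.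
apply: (term_order_add ltO); apply: (proj2 lead_l) => //.
by apply: contraNneq neq_m'm => kl; rewrite def_m' kl submK.
Qed.

Lemma lead_of_sum (a : K) (m0 : 'X_{1..N}) (g : {mpoly K[N]}) :
  a != 0 -> (forall m, m \in msupp g -> lt m m0) ->
  is_lead lt (a *: 'X_[m0] + g) m0.
Proof.
move=> a0 ltg; have g0 : g@_m0 = 0.
  apply: memN_msupp_eq0; apply/negP => /ltg.
  by rewrite (term_order_irr ltO).
split; first by rewrite mcoeff_msupp mcoeffD mcoeffZ mcoeffX eqxx mulr1 g0 addr0.
move=> m' /msuppD_le; rewrite mem_cat => /orP[/msuppZ_le|/ltg //].
by rewrite msuppX inE => /eqP-> /eqP.
Qed.

End LeadingMonomials.

Section GroebnerCriterion.

Variables (K : fieldType) (N : nat) (lt : rel 'X_{1..N}) (J : finType).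
Variables (F : J -> {mpoly K[N]}) (L : J -> 'X_{1..N}) (r : nat).
Hypotheses (ltO : term_order lt) (leadF : forall j, is_lead lt (F j) (L j)).
Hypothesis homF : forall j, F j \is r.-homog.

Definition standard (m : 'X_{1..N}) : bool := [forall j, ~~ (L j <= m)%MM].

Let inF := ideal_gen (family_pred F).

Let reduces m0 (f : {mpoly K[N]}) := exists2 h, inF h &
  forall m, m \in msupp (f - h) -> standard m /\ (m == m0) || lt m m0.

Let reducesD m0 f g : reduces m0 f -> reduces m0 g -> reduces m0 (f + g).
Proof.
move=> [h Ih stdf] [k Ik stdg]; exists (h + k); first exact: ideal_genD.
move=> m; rewrite opprD addrACA => /msuppD_le.
by rewrite mem_cat => /orP[/stdf|/stdg].
Qed.

Let reducesZ m0 a f : reduces m0 f -> reduces m0 (a *: f).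
Proof.
move=> [h Ih stdf]; exists (a%:MP * h); first exact: ideal_genMl.
by move=> m; rewrite mul_mpolyC -scalerBr => /msuppZ_le /stdf.
Qed.

Let reduces_sum m0 (s : seq 'X_{1..N}) (a : 'X_{1..N} -> K) :
  (forall m, m \in s -> reduces m0 'X_[m]) ->
  reduces m0 (\sum_(m <- s) a m *: 'X_[m]).
Proof.
elim: s => [|m s IHs] Hs.
  rewrite big_nil; exists 0; first exact: ideal_gen0.
  by move=> m; rewrite subr0 msupp0.
rewrite big_cons; apply: reducesD.
  by apply/reducesZ/Hs; rewrite inE eqxx.
by apply: IHs => k ks; apply: Hs; rewrite inE ks orbT.
Qed.

Let reduces_trans m1 m2 f : lt m1 m2 -> reduces m1 f -> reduces m2 f.
Proof.
move=> lt12 [h Ih stdf]; exists h => // m /stdf[std_m le_m]; split=> //.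
apply/orP; right; case/orP: le_m => [/eqP-> //|lt_m].
exact: (term_order_trans ltO) lt_m lt12.
Qed.

(** The division algorithm.  It stops because the members of [F] are
    homogeneous: a step stays among the finitely many monomials of one degree,
    so no appeal to the well-foundedness of [lt] is made. *)
Lemma monomial_reduces m : exists2 h, inF h &
  forall m', m' \in msupp ('X_[m] - h) ->
    standard m' /\ (m' == m) || lt m' m.
Proof.
change (reduces m 'X_[m]).
have [e] : exists e, mdeg m = e by exists (mdeg m).
have [k] : exists k, (#|[set b : 'X_{1..N < e.+1} | lt b m]| < k)%N by eexists.
elim: k m => // k IHk m; rewrite ltnS => le_k deg_m.
have [std_m|] := boolP (standard m).
  exists 0; first exact: ideal_gen0.
  by move=> m'; rewrite subr0 msuppX inE => /eqP->; rewrite eqxx.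
rewrite negb_forall => /existsP[j /negPn le_jm].
have step := reduction_step ltO (leadF j) le_jm.
set p := 'X_[m] - _ in step.
have -> : 'X_[m] = ((F j)@_(L j))^-1 *: ('X_[(m - L j)%MM] * F j) + p.
  by rewrite addrC subrK.
apply: reducesD.
  exists (((F j)@_(L j))^-1 *: ('X_[(m - L j)%MM] * F j)).
    rewrite -mul_mpolyC; do 2!apply: ideal_genMl.
    by apply: mem_ideal_gen; exists j.
  by move=> m'; rewrite subrr msupp0.
rewrite [p]mpolyE; apply: reduces_sum => m' /step[lt_m' [q qF def_m']].
have deg_m' : mdeg m' = e.
  rewrite def_m' mdegD (dhomog_mf (homF j) qF).
  by rewrite -(dhomog_mf (homF j) (proj1 (leadF j))) -mdegD submK.
have lt_m'e : (mdeg m' < e.+1)%N by rewrite deg_m'.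
apply: (reduces_trans lt_m'); apply: IHk => //.
apply: leq_trans le_k; apply: proper_card; apply/properP; split.
  apply/subsetP=> b; rewrite !inE => lt_b.
  exact: (term_order_trans ltO) lt_b lt_m'.
by exists (BMultinom lt_m'e); rewrite !inE ?(term_order_irr ltO).
Qed.

Variable I : {mpoly K[N]} -> Prop.
Hypotheses (I0 : I 0) (ID : forall f g, I f -> I g -> I (f + g)).
Hypotheses (IM : forall h f, I f -> I (h * f)) (FI : forall j, I (F j)).
Hypothesis I_standard :
  forall f, I f -> (forall m, m \in msupp f -> standard m) -> f = 0.

Let IB f g : I f -> I g -> I (f - g).
Proof. by move=> If Ig; apply: ID => //; rewrite -mulN1r; apply: IM. Qed.

Let inF_I f : inF f -> I f.
Proof. by apply: ideal_gen_sub => // _ [j ->]. Qed.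

Lemma ideal_gen_of_standard f : inF f <-> I f.
Proof.
split=> [/inF_I //|If].
have [h Ih std_h] : exists2 h, inF h &
    forall m, m \in msupp (f - h) -> standard m.
  rewrite [f]mpolyE; elim: (msupp f) => [|m s [h Ih std_h]].
    exists 0; first exact: ideal_gen0.
    by move=> m; rewrite big_nil subr0 msupp0.
  have [k Ik std_k] := monomial_reduces m.
  exists ((f@_m)%:MP * k + h); first exact/ideal_genD/Ih/ideal_genMl.
  move=> m'; rewrite big_cons opprD addrACA mul_mpolyC -scalerBr => /msuppD_le.
  by rewrite mem_cat => /orP[/msuppZ_le/std_k[]|/std_h].
suff /eqP : f - h = 0 by rewrite subr_eq0 => /eqP->.
by apply: I_standard => //; apply: IB => //; apply: inF_I.
Qed.

Lemma lead_not_standard f m : I f -> is_lead lt f m -> ~~ standard m.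
Proof.
move=> If lead_m; apply/negP => std_m.
have f_m := lead_coeff_neq0 lead_m.
pose t := f - f@_m *: 'X_[m].
have t_lt m' : m' \in msupp t -> lt m' m.
  have [->|ne_m'] := eqVneq m' m.
    by rewrite mcoeff_msupp mcoeffB mcoeffZ mcoeffX eqxx mulr1 subrr eqxx.
  rewrite mcoeff_msupp mcoeffB mcoeffZ mcoeffX [m == _]eq_sym (negPf ne_m') mulr0 subr0.
  by rewrite -mcoeff_msupp => /(proj2 lead_m); apply.
have [h Ih std_h] : exists2 h, inF h &
    forall m', m' \in msupp (t - h) -> standard m' /\ lt m' m.
  rewrite [t]mpolyE.
  have {t_lt}: forall m', m' \in msupp t -> lt m' m by [].
  elim: (msupp t) => [|k s IHs] t_lt.
    exists 0; first exact: ideal_gen0.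
    by move=> m'; rewrite big_nil subr0 msupp0.
  have [|h Ih std_h] := IHs; first by move=> q qs; apply: t_lt; rewrite inE qs orbT.
  have [q Iq std_q] := monomial_reduces k.
  exists ((t@_k)%:MP * q + h); first exact/ideal_genD/Ih/ideal_genMl.
  have lt_k : lt k m by apply: t_lt; rewrite inE eqxx.
  move=> m'; rewrite big_cons opprD addrACA mul_mpolyC -scalerBr => /msuppD_le.
  rewrite mem_cat => /orP[/msuppZ_le/std_q[std_m' le_m']|/std_h //]; split=> //.
  by case/orP: le_m' => [/eqP-> //|] /(term_order_trans ltO); apply.
have lt_th m' : m' \in msupp (t - h) -> lt m' m by case/std_h.
have [+ _] := lead_of_sum ltO f_m lt_th; suff -> : f@_m *: 'X_[m] + (t - h) = 0.
  by rewrite msupp0.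
apply: I_standard.
  have -> : f@_m *: 'X_[m] + (t - h) = f - h by rewrite /t; ring.
  by apply: IB => //; apply: inF_I.
move=> m' /msuppD_le; rewrite mem_cat => /orP[/msuppZ_le|/std_h[] //].
by rewrite msuppX inE => /eqP->.
Qed.

Lemma groebner_of_standard : groebner_basis lt (family_pred F) I.
Proof.
split=> [|_ [j ->]|h] //; split.
  case=> s Gs ->; exists s => // p /Gs[f [m [[j def_f] lead_m ->]]].
  by exists f, m; split; rewrite // def_f.
apply: ideal_gen_sub; [exact: ideal_gen0 | move=> *; exact: ideal_genD | |].
  by move=> *; apply: ideal_genMl.
move=> _ [f [m [If lead_m ->]]].
have := lead_not_standard If lead_m.
rewrite negb_forall => /existsP[j /negPn le_jm].
rewrite -(submK le_jm) mpolyXD; apply/ideal_genMl/mem_ideal_gen.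
by exists (F j), (L j); split=> //; exists j.
Qed.

End GroebnerCriterion.

Section Minimality.

Variables (K : fieldType) (N : nat) (lt : rel 'X_{1..N}) (J : finType).
Variables (F : J -> {mpoly K[N]}) (L : J -> 'X_{1..N}) (r : nat).
Hypotheses (ltO : term_order lt) (leadF : forall j, is_lead lt (F j) (L j)).
Hypotheses (homF : forall j, F j \is r.-homog) (injL : injective L).

Let homog_coefM (h f : {mpoly K[N]}) m :
  f \is r.-homog -> mdeg m = r -> (h * f)@_m = h@_0%MM * f@_m.
Proof.
move=> homf deg_m; rewrite {1}[h]mpolyE big_distrl /= raddf_sum /=.
have coefX k : k != 0%MM -> (h@_k *: 'X_[k] * f)@_m = 0.
  move=> k0; rewrite -scalerAl mcoeffZ mulrC mulrC.
  rewrite [('X_[k] * f)@_m]memN_msupp_eq0 ?mulr0 // mulrC (perm_mem (msuppMX _ _)).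
  apply/mapP => -[q qf def_m]; move: deg_m; rewrite def_m mdegD.
  rewrite (dhomog_mf homf qf) => /eqP; rewrite -[X in _ == X]add0n eqn_add2r.
  by rewrite mdeg_eq0 (negPf k0).
have [h0|h0] := boolP (0%MM \in msupp h).
  rewrite (bigD1_seq 0%MM) ?msupp_uniq //= big1 ?addr0 //.
  by rewrite mpolyX0 -scalerAl mul1r mcoeffZ.
rewrite (memN_msupp_eq0 h0) mul0r big_seq big1 // => k ks; apply: coefX.
by apply: contraNneq h0 => <-.
Qed.

Lemma exists_max_lead (P : pred J) i0 : P i0 ->
  exists2 i, P i & forall k, P k -> k != i -> lt (L k) (L i).
Proof.
have [n le_n] : exists n, (#|[set k | P k & lt (L i0) (L k)]| < n)%N by eexists.
elim: n i0 le_n => // n IHn i0; rewrite ltnS => le_n Pi0.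
have [[k /andP[Pk lt_k]]|nlt] := altP (existsP (P := fun k => P k && lt (L i0) (L k))).
  apply: (IHn k) => //; apply: leq_trans le_n; apply: proper_card; apply/properP; split.
    apply/subsetP=> q; rewrite !inE => /andP[-> lt_q].
    exact: (term_order_trans ltO) lt_k lt_q.
  by exists k; rewrite inE Pk ?lt_k ?(term_order_irr ltO).
exists i0 => // k Pk ne_k; move: nlt; rewrite negb_exists => /forallP/(_ k).
rewrite Pk /= => /negPf nlt.
have /(term_order_total ltO) : L k != L i0 by rewrite (inj_eq injL).
by rewrite nlt orbF.
Qed.

(** In the lowest degree only the constant terms of the coefficients matter, so
    a redundancy would be a linear relation; distinct leading monomials rule
    it out. *)
Lemma irredundant_of_distinct_leads j :
  ~ ideal_gen (fun f => exists2 i, i != j & f = F i) (F j).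
Proof.
move=> /ideal_gen_family[H defF].
pose a i := if i == j then -1 else (H i)@_0%MM.
have rel m : mdeg m = r -> \sum_i a i * (F i)@_m = 0.
  move=> deg_m; rewrite (bigD1 j) //= {1}/a eqxx mulN1r {1}defF raddf_sum /=.
  rewrite -sumrN -big_split big1 //= => i ne_ij.
  by rewrite homog_coefM // /a (negPf ne_ij) addNr.
have [|i a_i max_i] := @exists_max_lead (fun i => a i != 0) j.
  by rewrite /a eqxx oppr_eq0 oner_eq0.
have deg_i : mdeg (L i) = r := dhomog_mf (homF i) (proj1 (leadF i)).
move/eqP: (rel _ deg_i); rewrite (bigD1 i) //= big1 ?addr0 => [|k ne_ki].
  by rewrite mulf_eq0 (negPf a_i) (negPf (lead_coeff_neq0 (leadF i))).
have [->|a_k] := eqVneq (a k) 0; first exact: mul0r.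
have lt_k := max_i k a_k ne_ki; rewrite [(F k)@__]memN_msupp_eq0 ?mulr0 //.
apply/negP => Fk; have [eqL|neL] := eqVneq (L i) (L k).
  by move: lt_k; rewrite eqL (term_order_irr ltO).
have lt_i := proj2 (leadF k) _ Fk neL.
by have := term_order_trans ltO lt_i lt_k; rewrite (term_order_irr ltO).
Qed.

End Minimality.

(** * The term order *)

Section LexOrder.

Variables (I : finType) (before : rel I).
Hypotheses (before_irr : irreflexive before) (before_trans : transitive before).
Hypothesis before_total : forall i j, i != j -> before i j || before j i.

Local Open Scope nat_scope.

Implicit Types u v w : I -> nat.

Lemma lex_ltP u v :
  reflect (exists2 i, u i < v i & forall j, before j i -> u j = v j)
          (lex_lt before u v).
Proof.
apply: (iffP existsP) => [[i /andP[lt_i /forall_inP eq_i]]|[i lt_i eq_i]].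
  by exists i => // j /eq_i /eqP.
by exists i; rewrite lt_i; apply/forall_inP => j /eq_i->.
Qed.

Lemma lex_lt_irr u : lex_lt before u u = false.
Proof. by apply/lex_ltP => -[i]; rewrite ltnn. Qed.

Lemma lex_lt_trans v u w :
  lex_lt before u v -> lex_lt before v w -> lex_lt before u w.
Proof.
move=> /lex_ltP[i lt_i eq_i] /lex_ltP[j lt_j eq_j]; apply/lex_ltP.
have [eq_ij|ne_ij] := eqVneq i j.
  exists i; first by rewrite eq_ij in lt_i *; lia.
  by move=> k ki; rewrite eq_i // eq_j // -eq_ij.
case/orP: (before_total ne_ij) => [ij|ji].
  exists i; first by rewrite -(eq_j i).
  by move=> k ki; rewrite eq_i // eq_j //; apply: before_trans ij.
exists j; first by rewrite (eq_i j).
by move=> k kj; rewrite eq_i ?eq_j //; apply: before_trans ji.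
Qed.

Lemma lex_lt_total u v i :
  u i != v i -> lex_lt before u v || lex_lt before v u.
Proof.
move=> ne_i; pose below k := #|[pred j | before j k]|.
case: (arg_minnP (P := fun k => u k != v k) below ne_i) => k ne_k min_k.
have eq_k j : before j k -> u j = v j.
  move=> jk; apply: contraTeq jk => /min_k; apply: contraTN => jk.
  rewrite -ltnNge; apply: proper_card; apply/properP; split.
    by apply/subsetP=> l; rewrite !inE => /before_trans; apply.
  by exists j; rewrite !inE ?before_irr.
case: (ltngtP (u k) (v k)) => [lt_k|lt_k|eq_uv].
- by apply/orP; left; apply/lex_ltP; exists k.
- by apply/orP; right; apply/lex_ltP; exists k => // j /eq_k.
- by rewrite eq_uv eqxx in ne_k.
Qed.

Lemma lex_ltD u v u' v' w : (forall i, u' i = u i + w i) ->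
  (forall i, v' i = v i + w i) -> lex_lt before u v -> lex_lt before u' v'.
Proof.
move=> Du Dv /lex_ltP[i lt_i eq_i]; apply/lex_ltP; exists i.
  by rewrite Du Dv ltn_add2r.
by move=> j ji; rewrite Du Dv eq_i.
Qed.

Lemma eq_lex_lt u v u' v' :
  u =1 u' -> v =1 v' -> lex_lt before u v = lex_lt before u' v'.
Proof.
move=> equ eqv; apply/lex_ltP/lex_ltP => -[i lt_i eq_i].
  by exists i; rewrite -?equ -?eqv // => j /eq_i; rewrite equ eqv.
by exists i; rewrite ?equ ?eqv // => j /eq_i; rewrite equ eqv.
Qed.

End LexOrder.

Section FiberOrder.

Variables (d : nat) (n : 'I_d -> nat).
Local Notation c := (scroll_c n).
Local Notation mon := 'X_{1..fiber_nvars n}.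

Local Open Scope nat_scope.

Lemma fst_lt_snd (p : incr 2 c) : fst_idx p < snd_idx p.
Proof.
case: p => t /=; rewrite /fst_idx /snd_idx /=.
case/tupleP: t => a t; case/tupleP: t => b t; rewrite tuple0 /= andbT.
by rewrite !(tnth_nth a).
Qed.

Lemma incr2_eq (p q : incr 2 c) :
  fst_idx p = fst_idx q -> snd_idx p = snd_idx q -> p = q.
Proof.
rewrite /fst_idx /snd_idx => eq1 eq2; apply/val_inj/eq_from_tnth => i.
have [->|->] : i = ord0 \/ i = ord_max by case: i => [[|[|i]] ltk] //;
  [left | right]; apply: val_inj.
  exact: eq1.
exact: eq2.
Qed.

Lemma T_before_irr : irreflexive (@T_before d n).
Proof. by move=> p; rewrite /T_before !ltnn andbF. Qed.

Lemma T_before_trans : transitive (@T_before d n).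
Proof.
move=> q p r; rewrite /T_before => /orP[lt1|/andP[/eqP eq1 lt2]].
  by move=> /orP[/(ltn_trans lt1)->//|/andP[/eqP<- _]]; rewrite lt1.
case/orP=> [lt1|/andP[/eqP eq1' lt2']]; first by rewrite eq1 lt1.
by rewrite eq1 eq1' eqxx (ltn_trans lt2 lt2') orbT.
Qed.

Lemma T_before_total p q : p != q -> @T_before d n p q || @T_before d n q p.
Proof.
move=> ne_pq; rewrite /T_before -!(inj_eq val_inj) /=.
case: (ltngtP (fst_idx p) (fst_idx q)) => //= eq1.
case: (ltngtP (snd_idx p) (snd_idx q)) => //= eq2.
by case/eqP: ne_pq; apply: incr2_eq; apply: val_inj.
Qed.

Lemma fiber_mdegD (m m' : mon) k :
  fiber_mdeg (m + m')%MM k = fiber_mdeg m k + fiber_mdeg m' k.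
Proof.
by rewrite /fiber_mdeg -big_split; apply: eq_bigr => p _; rewrite mnmDE mulnDl.
Qed.

Lemma fiber_sdegD (m m' : mon) :
  fiber_sdeg (m + m')%MM = fiber_sdeg m + fiber_sdeg m'.
Proof.
by rewrite /fiber_sdeg -big_split; apply: eq_bigr => p _; rewrite mnmDE mulnDl.
Qed.

Let position := 'I_(c + d).
Let pos_lt : rel position := fun k l => k < l.

Let pos_trans : transitive pos_lt. Proof. by move=> ? ? ?; apply: ltn_trans. Qed.
Let pos_irr : irreflexive pos_lt. Proof. by move=> ?; apply: ltnn. Qed.
Let pos_total (i j : position) : i != j -> pos_lt i j || pos_lt j i.
Proof. by move=> ne_ij; rewrite /pos_lt -neq_ltn. Qed.

Variant fiber_lt_spec (m m' : mon) : Prop :=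
| FiberLtMdeg of lex_lt pos_lt (fiber_mdeg m) (fiber_mdeg m')
| FiberLtSdeg of fiber_mdeg m =1 fiber_mdeg m' & fiber_sdeg m < fiber_sdeg m'
| FiberLtLex of fiber_mdeg m =1 fiber_mdeg m' & fiber_sdeg m = fiber_sdeg m' &
    lex_lt (@T_before d n) (fun p => m (enum_rank p)) (fun p => m' (enum_rank p)).

Lemma fiber_ltP (m m' : mon) : reflect (fiber_lt_spec m m') (fiber_lt n m m').
Proof.
apply: (iffP orP) => [[lt_m|/andP[/forallP eq_m]]|].
- exact: FiberLtMdeg.
- have eqm : fiber_mdeg m =1 fiber_mdeg m' by move=> k; apply/eqP.
  by case/orP=> [|/andP[/eqP]]; [apply: FiberLtSdeg | apply: FiberLtLex].
case=> [lt_m|eq_m lt_m|eq_m eq_s lt_m]; [by left | right | right].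
  by rewrite lt_m andbT; apply/forallP => k; rewrite eq_m.
by rewrite eq_s eqxx lt_m orbT andbT; apply/forallP => k; rewrite eq_m.
Qed.

Lemma fiber_lt_irr : irreflexive (fiber_lt n).
Proof.
move=> m; apply/fiber_ltP; case=> [|_|_ _]; rewrite ?ltnn ?lex_lt_irr //.
Qed.

Lemma fiber_lt_trans : transitive (fiber_lt n).
Proof.
move=> m2 m1 m3 /fiber_ltP[lt1|eq1 lt1|eq1 s1 lt1];
  case/fiber_ltP=> [lt2|eq2 lt2|eq2 s2 lt2]; apply/fiber_ltP.
- by apply: FiberLtMdeg; apply: lex_lt_trans lt2.
- by apply: FiberLtMdeg; rewrite -(eq_lex_lt _ (frefl _) eq2).
- by apply: FiberLtMdeg; rewrite -(eq_lex_lt _ (frefl _) eq2).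
- by apply: FiberLtMdeg; rewrite (eq_lex_lt _ eq1 (frefl _)).
- by apply: FiberLtSdeg; [apply: ftrans eq2 | apply: ltn_trans lt2].
- by apply: FiberLtSdeg; [apply: ftrans eq2 | rewrite -s2].
- by apply: FiberLtMdeg; rewrite (eq_lex_lt _ eq1 (frefl _)).
- by apply: FiberLtSdeg; [apply: ftrans eq2 | rewrite s1].
- apply: FiberLtLex; [exact: ftrans eq2 | by rewrite s1 |].
  exact: lex_lt_trans T_before_trans T_before_total _ _ _ lt1 lt2.
Qed.

Lemma fiber_lt_total (m m' : mon) : m != m' -> fiber_lt n m m' || fiber_lt n m' m.
Proof.
move=> ne_m.
have [/forallP eq_d|] := boolP [forall k, fiber_mdeg m k == fiber_mdeg m' k].
  have eq_d' : fiber_mdeg m =1 fiber_mdeg m' by move=> k; apply/eqP.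
  case: (ltngtP (fiber_sdeg m) (fiber_sdeg m')) => [lt_s|lt_s|eq_s].
  - by apply/orP; left; apply/fiber_ltP/FiberLtSdeg.
  - by apply/orP; right; apply/fiber_ltP/FiberLtSdeg.
  have [i ne_i] : exists i, m i != m' i.
    apply/existsP; rewrite -negb_forall; apply: contra ne_m => /forallP eq_i.
    by apply/eqP/mnmP => i; apply/eqP.
  have ne_p : m (enum_rank (enum_val i)) != m' (enum_rank (enum_val i)).
    by rewrite enum_valK.
  have := lex_lt_total T_before_irr T_before_trans (u := fun p => m (enum_rank p))
    (v := fun p => m' (enum_rank p)) ne_p.
  case/orP=> lt_m; apply/orP; [left | right]; apply/fiber_ltP/FiberLtLex => //.
rewrite negb_forall => /existsP[k /(lex_lt_total pos_irr pos_trans)].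
by case/orP => lt_m; apply/orP; [left | right]; apply/fiber_ltP/FiberLtMdeg.
Qed.

Lemma fiber_lt_add (m1 m2 m : mon) :
  fiber_lt n m1 m2 -> fiber_lt n (m1 + m)%MM (m2 + m)%MM.
Proof.
case/fiber_ltP=> [lt1|eq1 lt1|eq1 s1 lt1]; apply/fiber_ltP.
- by apply: FiberLtMdeg; apply: lex_ltD lt1 => k; apply: fiber_mdegD.
- by apply: FiberLtSdeg => [k|]; rewrite ?fiber_mdegD ?eq1 // !fiber_sdegD ltn_add2r.
- apply: FiberLtLex => [k||]; rewrite ?fiber_mdegD ?eq1 // ?fiber_sdegD ?s1 //.
  by apply: lex_ltD lt1 => p; apply: mnmDE.
Qed.

Lemma fiber_mdeg0 k : fiber_mdeg (0%MM : mon) k = 0.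
Proof. by rewrite /fiber_mdeg big1 // => p _; rewrite mnm0E. Qed.

Lemma fiber_lt_min (m : mon) : m != 0%MM -> fiber_lt n 0%MM m.
Proof.
move=> m0; have := fiber_lt_total m0; case/orP=> // /fiber_ltP lt_m.
have nlt0 (J : finType) (B : rel J) u v : v =1 (fun=> 0) -> ~ lex_lt B u v.
  by move=> v0 /lex_ltP[j]; rewrite v0.
exfalso; case: lt_m => [|_|_ _].
- by apply: nlt0 => k; apply: fiber_mdeg0.
- by rewrite [X in _ < X]/fiber_sdeg big1 // => p _; rewrite mnm0E.
- by apply: nlt0 => p; apply: mnm0E.
Qed.

Lemma fiber_term_order : term_order (fiber_lt n).
Proof.
split; [exact: fiber_lt_irr | exact: fiber_lt_trans | exact: fiber_lt_total | |].
- exact: fiber_lt_add.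
- exact: fiber_lt_min.
Qed.

End FiberOrder.

(** * The columns of the scroll matrix *)

Section Columns.

Variables (d : nat) (n : 'I_d -> nat).
Hypotheses (d_gt0 : (0 < d)%N) (n_gt0 : forall i, (0 < n i)%N).
Hypothesis n_homo : forall i j : 'I_d, (i <= j)%N -> (n i <= n j)%N.

Local Notation c := (scroll_c n).
Local Notation columns := (scroll_columns n).
Local Open Scope nat_scope.

Definition column (a : nat) : 'I_d * nat := nth (Ordinal d_gt0, 0) columns a.
Definition column_index (p : 'I_d * nat) : nat := index p columns.

(** The columns that are followed by another one in their block: those of the
    first part of the matrix. *)
Definition inner (p : 'I_d * nat) : bool := p.2.+2 <= n p.1.

Definition col_before (p q : 'I_d * nat) : bool :=
  if inner p then inner q ==> ((p.2 < q.2) || (p.2 == q.2) && (p.1 < q.1))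
  else ~~ inner q && (q.1 < p.1).

Lemma col_before_irr : irreflexive col_before.
Proof. by move=> p; rewrite /col_before; case: ifP => //=; lia. Qed.

Lemma col_before_trans : transitive col_before.
Proof.
move=> q p r; rewrite /col_before.
by case: (inner p); case: (inner q); case: (inner r) => //=; lia.
Qed.

Lemma scroll_columns_pairwise : pairwise col_before columns.
Proof.
have enum_sorted : sorted (fun i j : 'I_d => i < j) (enum 'I_d).
  by have := iota_ltn_sorted 0 d; rewrite -val_enum_ord sorted_map.
have ord_trans : transitive (fun i j : 'I_d => i < j).
  by move=> ? ? ?; apply: ltn_trans.
rewrite /scroll_columns pairwise_cat; apply/and3P; split.
- apply/allrelP => p q /flattenP[s /mapP[j _ ->] /mapP[i]].
  rewrite mem_filter => /andP[inn _] -> /mapP[k _ ->].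
  by rewrite /col_before /inner /= inn; have := n_gt0 k; case: leqP => //=; lia.
- move: 0 => k; elim: c k => //= m IHm k; rewrite pairwise_cat; apply/and3P; split=> //.
    apply/allrelP => p q /mapP[i]; rewrite mem_filter => /andP[inn _] ->.
    case/flattenP=> s /mapP[j]; rewrite mem_iota => lt_j -> /mapP[i'].
    rewrite mem_filter => /andP[inn' _] ->.
    rewrite /col_before /inner /= inn inn' /=; lia.
  rewrite pairwise_map; set inn := [pred i : 'I_d | k.+2 <= n i].
  apply: (@sub_in_pairwise _ inn (fun i j : 'I_d => i < j)).
  - move=> i i'; rewrite /col_before /inner !inE /= => -> -> /= -> .
    by rewrite eqxx orbT.
  - exact: filter_all.
  - by apply: pairwise_filter; rewrite -sorted_pairwise.
rewrite pairwise_map -sorted_pairwise; last first.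
  by move=> j i k; apply: col_before_trans.
rewrite rev_sorted; apply: sub_sorted enum_sorted => i j lt_ij /=.
have last_col k : inner (k, (n k).-1) = false.
  by rewrite /inner /=; have := n_gt0 k; lia.
by rewrite /col_before !last_col.
Qed.

Lemma columns_uniq : uniq columns.
Proof. exact: pairwise_uniq col_before_irr scroll_columns_pairwise. Qed.

Let sz : size columns = c := size_scroll_columns n_gt0.

Lemma mem_column a : a < c -> (column a).2 < n (column a).1.
Proof. by move=> lt_a; rewrite -mem_scroll_columns // mem_nth ?sz. Qed.

Lemma columnK a : a < c -> column_index (column a) = a.
Proof. by move=> lt_a; rewrite /column_index index_uniq ?sz ?columns_uniq. Qed.

Lemma column_index_lt p : p.2 < n p.1 -> column_index p < c.
Proof. by rewrite -sz index_mem mem_scroll_columns. Qed.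

Lemma column_indexK p : p.2 < n p.1 -> column (column_index p) = p.
Proof. by move=> lt_p; apply: nth_index; rewrite mem_scroll_columns. Qed.

Lemma ltn_column a b : a < c -> b < c -> (a < b) = col_before (column a) (column b).
Proof.
move=> lt_a lt_b; have col_mono i j : i < j -> j < c -> col_before (column i) (column j).
  move=> lt_ij lt_j.
  have /(pairwiseP (Ordinal d_gt0, 0)) := scroll_columns_pairwise.
  by apply=> //; rewrite inE sz // (ltn_trans lt_ij).
case: (ltngtP a b) => [lt_ab|lt_ba|->]; last by rewrite col_before_irr.
  by rewrite col_mono.
apply/esym/negP => /col_before_trans/(_ (col_mono _ _ lt_ba lt_a)).
by rewrite col_before_irr.
Qed.

Lemma inner_column a : a < c -> inner (column a) = (a < c - d).
Proof.
move=> lt_a; rewrite /inner /column /scroll_columns nth_cat.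
have := sz; rewrite /scroll_columns size_cat; set s := flatten _.
rewrite size_map size_rev size_enum_ord => sz'; have -> : c - d = size s by lia.
case: (ltnP a (size s)) => [lt_as|le_sa].
  have /flattenP[t /mapP[k _ ->]] := mem_nth (Ordinal d_gt0, 0) lt_as.
  by case/mapP => i + ->; rewrite mem_filter => /andP[].
have lt_r : a - size s < size [seq (i, (n i).-1) | i <- rev (enum 'I_d)].
  by rewrite size_map size_rev size_enum_ord; lia.
have /mapP[i _ ->] := mem_nth (Ordinal d_gt0, 0) lt_r.
by have := n_gt0 i; rewrite /=; lia.
Qed.

(** The map [overline] on plain numbers, which avoids the bound on its
    argument; it agrees with [overline] below [c - d]. *)
Definition next_column (a : nat) : nat := column_index (scroll_shift (column a)).

Lemma overlineE (a : 'I_(c - d)) : overline a = next_column a :> nat.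
Proof.
have := overlineP a (Ordinal d_gt0, 0) n_gt0.
by rewrite /next_column -/(column a) -/(column _) => <-; rewrite columnK.
Qed.

Section Next.

Variable a : nat.
Hypothesis lt_a : a < c - d.

Let lt_ac : a < c. Proof. by lia. Qed.
Let inner_a : inner (column a). Proof. by rewrite inner_column. Qed.

Lemma next_column_lt : next_column a < c. Proof. exact: column_index_lt. Qed.

Lemma column_next : column (next_column a) = scroll_shift (column a).
Proof. exact: column_indexK. Qed.

Lemma ltn_next_column : a < next_column a.
Proof.
rewrite ltn_column ?next_column_lt // column_next /col_before inner_a /=.
by apply/implyP => _; rewrite ltnSn.
Qed.

End Next.

Lemma next_column_inj a b : a < c - d -> b < c - d -> next_column a = next_column b -> a = b.
Proof.
move=> lt_a lt_b eq_ab.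
have eq_s : scroll_shift (column a) = scroll_shift (column b).
  by rewrite -!column_next // eq_ab.
have eq_c : column a = column b.
  by move: eq_s; case: (column a) (column b) => i j [i' j'] [-> ->].
by rewrite -[a]columnK ?eq_c ?columnK //; lia.
Qed.

Lemma column_next_exists v : v < c -> 0 < (column v).2 ->
  exists2 e, e < c - d & next_column e = v /\ column e = ((column v).1, (column v).2.-1).
Proof.
move=> lt_v v2; have lt_cv := mem_column lt_v.
pose p := ((column v).1, (column v).2.-1).
have lt_p : p.2 < n p.1 by rewrite /=; lia.
have colE := column_indexK lt_p; exists (column_index p).
  by rewrite -inner_column ?column_index_lt // colE /inner /=; lia.
split=> //; rewrite /next_column colE /scroll_shift /= prednK //.
by rewrite -[(_, _)]surjective_pairing columnK.
Qed.

(** The reversed order of the last columns and the monotonicity of the block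
    lengths serve this purpose: an index [v] among the last columns, before the
    successor of [a2], belongs to a later block, at least as long as that of
    [a2], so that its predecessor comes after [a2]. *)
Lemma next_convex b a1 a2 v :
  b < a1 -> a1 < c - d -> b < a2 -> a2 < c - d ->
  next_column a1 < v -> v < next_column a2 ->
  exists2 e, b < e < c - d & next_column e = v.
Proof.
move=> lt_b1 lt_1 lt_b2 lt_2 lt_1v lt_v2.
have lt_v : v < c by apply: ltn_trans lt_v2 (next_column_lt lt_2).
have := lt_b2; rewrite ltn_column; [|lia..] => before_b2.
have := lt_b1; rewrite ltn_column; [|lia..] => before_b1.
have := lt_v2; rewrite ltn_column ?next_column_lt // column_next // => before_v2.
have := lt_1v; rewrite ltn_column ?next_column_lt // column_next // => before_1v.
have inn_b : inner (column b) by rewrite inner_column; lia.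
have inn1 : inner (column a1) by rewrite inner_column; lia.
have inn2 : inner (column a2) by rewrite inner_column; lia.
have lt_cv := mem_column lt_v.
have n_le : (column a2).1 < (column v).1 -> n (column a2).1 <= n (column v).1.
  by move/ltnW/n_homo.
move: before_1v before_v2 before_b1 before_b2; rewrite /col_before /=.
rewrite inn_b inn1 inn2 /= => before_1v before_v2 before_b1 before_b2.
have v2 : 0 < (column v).2.
  case inn_v: (inner (column v)) before_1v before_v2 => /=.
    by case: ifP => //= _; lia.
  move=> _ /andP[_ lt_i]; move: (n_le lt_i) inn2 inn_v.
  by rewrite /inner; lia.
have [e lt_e [next_e col_e]] := column_next_exists lt_v v2.
exists e => //; rewrite lt_e andbT ltn_column; [|lia..].
rewrite /col_before inn_b col_e /=; apply/implyP => _.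
case inn_v: (inner (column v)) before_1v before_v2 => /=.
  by case: ifP => //= _; lia.
move=> _ /andP[_ lt_i]; move: (n_le lt_i) inn2 inn_v.
by rewrite /inner; lia.
Qed.

End Columns.

(** * Leading monomials of the generators *)

Lemma ord_neq_ltn m (a b : 'I_m) : (a != b) = ((a < b) || (b < a))%N.
Proof. exact: neq_ltn. Qed.

Section PairMonomials.

Variables (d : nat) (n : 'I_d -> nat).
Local Notation c := (scroll_c n).
Local Notation mon := 'X_{1..fiber_nvars n}.

Definition ordered_pair_mon (a b : 'I_c) : mon :=
  if insub [tuple a; b] is Some p then U_(enum_rank (p : incr 2 c))%MM else 0%MM.

(** The exponent of [T_(a,b)], whichever of the two indices is the smaller: at
    most one of the two summands is nonzero. *)
Definition pair_mon (a b : 'I_c) : mon :=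
  (ordered_pair_mon a b + ordered_pair_mon b a)%MM.

Lemma pair_monC a b : pair_mon a b = pair_mon b a.
Proof. exact: addmC. Qed.

Lemma insub_pair_lt (a b : 'I_c) : (a < b)%N ->
  exists p : incr 2 c, [/\ fst_idx p = a, snd_idx p = b,
    insub [tuple a; b] = Some p & insub [tuple b; a] = None :> option (incr 2 c)].
Proof.
move=> lt_ab; have inc : sorted ltn [seq nat_of_ord i | i <- [tuple a; b]].
  by rewrite /= lt_ab.
exists (Sub [tuple a; b] inc); split=> //; first exact: insubT.
by apply: insubF; rewrite /= andbT; lia.
Qed.

Lemma pair_mon_lt (a b : 'I_c) : (a < b)%N ->
  exists p : incr 2 c,
    [/\ fst_idx p = a, snd_idx p = b & pair_mon a b = U_(enum_rank p)%MM].
Proof.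
move=> /insub_pair_lt[p [fp sp insub_ab insub_ba]]; exists p; split=> //.
by rewrite /pair_mon /ordered_pair_mon insub_ab insub_ba addm0.
Qed.

Lemma pair_mon_idx (p : incr 2 c) :
  pair_mon (fst_idx p) (snd_idx p) = U_(enum_rank p)%MM.
Proof.
have [q [fq sq ->]] := pair_mon_lt (fst_lt_snd p).
by rewrite (incr2_eq fq sq).
Qed.

Lemma pair_mon_neq (a b : 'I_c) : a != b ->
  exists p : incr 2 c, [/\ fst_idx p = minn a b :> nat,
    snd_idx p = maxn a b :> nat & pair_mon a b = U_(enum_rank p)%MM].
Proof.
rewrite ord_neq_ltn => /orP[] lt_ab; have [p [fp sp def_p]] := pair_mon_lt lt_ab.
  by exists p; split=> //; rewrite ?fp ?sp; lia.
by rewrite pair_monC; exists p; split=> //; rewrite ?fp ?sp; lia.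
Qed.

Lemma fiber_mdegU (p : incr 2 c) (k : 'I_(c + d)) :
  fiber_mdeg (U_(enum_rank p)%MM : mon) k =
  ((k == fst_idx p + d :> nat) + (k == snd_idx p + d :> nat))%N.
Proof.
rewrite /fiber_mdeg (bigD1 p) //= mnm1E eqxx mul1n big1 ?addn0 // => q ne_qp.
by rewrite mnm1E (inj_eq enum_rank_inj) eq_sym (negPf ne_qp) mul0n.
Qed.

Lemma fiber_sdegU (p : incr 2 c) :
  fiber_sdeg (U_(enum_rank p)%MM : mon) = (c - (fst_idx p).+1)%N.
Proof.
rewrite /fiber_sdeg (bigD1 p) //= mnm1E eqxx mul1n big1 ?addn0 // => q ne_qp.
by rewrite mnm1E (inj_eq enum_rank_inj) eq_sym (negPf ne_qp) mul0n.
Qed.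

Lemma fiber_mdeg_pair (a b : 'I_c) (k : 'I_(c + d)) : a != b ->
  fiber_mdeg (pair_mon a b) k = ((k == a + d :> nat) + (k == b + d :> nat))%N.
Proof.
by move=> /pair_mon_neq[p [fp sp ->]]; rewrite fiber_mdegU fp sp; lia.
Qed.

Lemma fiber_sdeg_pair (a b : 'I_c) : a != b ->
  fiber_sdeg (pair_mon a b) = (c - (minn a b).+1)%N.
Proof. by move=> /pair_mon_neq[p [fp sp ->]]; rewrite fiber_sdegU fp. Qed.

Lemma pair_monE (a b : 'I_c) (q : incr 2 c) : (a < b)%N ->
  pair_mon a b (enum_rank q) = (fst_idx q == a) && (snd_idx q == b) :> nat.
Proof.
move=> /pair_mon_lt[p [<- <- ->]]; rewrite mnm1E (inj_eq enum_rank_inj) eq_sym.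
by congr nat_of_bool; apply/eqP/andP => [-> //|[/eqP e1 /eqP e2]]; apply: incr2_eq.
Qed.

Lemma fiber_mdeg_pair2 (a b u v : 'I_c) (k : 'I_(c + d)) : a != b -> u != v ->
  fiber_mdeg (pair_mon a b + pair_mon u v)%MM k =
  ((k == a + d :> nat) + (k == b + d :> nat) +
   ((k == u + d :> nat) + (k == v + d :> nat)))%N.
Proof. by move=> neq_ab neq_uv; rewrite fiber_mdegD // !fiber_mdeg_pair. Qed.

Lemma fiber_sdeg_pair2 (a b u v : 'I_c) : (a < b)%N -> (u < v)%N ->
  fiber_sdeg (pair_mon a b + pair_mon u v)%MM = (c - a.+1 + (c - u.+1))%N.
Proof.
move=> ab uv; rewrite fiber_sdegD !fiber_sdeg_pair ?ord_neq_ltn ?ab ?uv //.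
by congr (_ - _.+1 + (_ - _.+1))%N; apply/minn_idPl/ltnW.
Qed.

Lemma pair_mon2E (a b u v : 'I_c) (q : incr 2 c) : (a < b)%N -> (u < v)%N ->
  (pair_mon a b + pair_mon u v)%MM (enum_rank q) =
  ((fst_idx q == a :> nat) && (snd_idx q == b :> nat)
   + (fst_idx q == u :> nat) && (snd_idx q == v :> nat))%N.
Proof. by move=> ab uv; rewrite mnmDE !pair_monE. Qed.

Lemma mdeg_pair (a b : 'I_c) : a != b -> mdeg (pair_mon a b) = 1%N.
Proof. by move=> /pair_mon_neq[p [_ _ ->]]; rewrite mdeg1. Qed.

(** In both comparisons below the larger monomial is the one whose indices are
    [a], [b] and two more, all beyond [b]. *)
Lemma fiber_lt_second (a b u v b' u' v' : 'I_c) :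
  (a < b < u)%N -> (b < v)%N -> u != v ->
  (b < b')%N -> (b < u')%N -> (b < v')%N -> u' != v' ->
  fiber_lt n (pair_mon a b' + pair_mon u' v')%MM (pair_mon a b + pair_mon u v)%MM.
Proof.
move=> /andP[ab bu] bv uv bb' bu' bv' uv'; apply/fiber_ltP/FiberLtMdeg.
have lt_k : (b + d < c + d)%N by rewrite ltn_add2r.
have neq (i j : 'I_c) : (i < j)%N -> i != j by rewrite ord_neq_ltn => ->.
have [neq_ab neq_ab'] : a != b /\ a != b' by split; apply: neq; lia.
apply/lex_ltP; exists (Ordinal lt_k) => [|j];
  by rewrite /= !fiber_mdeg_pair2 //=; lia.
Qed.

Lemma fiber_lt_first (a b u v a' b' u' v' : 'I_c) :
  (a < b < u)%N -> (b < v)%N -> u != v ->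
  (a < a')%N -> (a < b')%N -> (a < u')%N -> (a < v')%N -> a' != b' -> u' != v' ->
  fiber_lt n (pair_mon a' b' + pair_mon u' v')%MM (pair_mon a b + pair_mon u v)%MM.
Proof.
move=> /andP[ab bu] bv uv aa' ab' au' av' neq1 neq2; apply/fiber_ltP/FiberLtMdeg.
have lt_k : (a + d < c + d)%N by rewrite ltn_add2r.
have neq_ab : a != b by rewrite ord_neq_ltn ab.
apply/lex_ltP; exists (Ordinal lt_k) => [|j];
  by rewrite /= !fiber_mdeg_pair2 //=; lia.
Qed.

(** Both sides have the same [fiber_mdeg]; the right one wins because its two
    arcs start at the two smallest indices. *)
Lemma fiber_lt_disjoint (a b u v : 'I_c) : (a < b < u)%N -> (u < v)%N ->
  fiber_lt n (pair_mon a b + pair_mon u v)%MM (pair_mon a u + pair_mon b v)%MM.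
Proof.
move=> /andP[ab bu] uv; have neq (i j : 'I_c) : (i < j)%N -> i != j.
  by rewrite ord_neq_ltn => ->.
have := ltn_ord v => vc.
have [au bv] : (a < u)%N /\ (b < v)%N by lia.
have [nab nuv nau nbv] : [/\ a != b, u != v, a != u & b != v] by split; apply: neq.
apply/fiber_ltP/FiberLtSdeg => [k|].
  by rewrite !fiber_mdeg_pair2 //; lia.
by rewrite !fiber_sdeg_pair2 //; lia.
Qed.

(** Here [fiber_sdeg] does not decide either, and the comparison is made at the
    variable [T_(a,u)]. *)
Lemma fiber_lt_nested (a b u v : 'I_c) : (a < b < u)%N -> (u < v)%N ->
  fiber_lt n (pair_mon a v + pair_mon b u)%MM (pair_mon a u + pair_mon b v)%MM.
Proof.
move=> /andP[ab bu] uv; have neq (i j : 'I_c) : (i < j)%N -> i != j.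
  by rewrite ord_neq_ltn => ->.
have [au [bv av]] : (a < u)%N /\ (b < v)%N /\ (a < v)%N by lia.
have [nav nbu nau nbv] : [/\ a != v, b != u, a != u & b != v] by split; apply: neq.
apply/fiber_ltP/FiberLtLex => [k||].
- by rewrite !fiber_mdeg_pair2 //; lia.
- by rewrite !fiber_sdeg_pair2 //; lia.
have [p [fp sp _]] := pair_mon_lt au.
apply/lex_ltP; exists p => [|q].
  by rewrite !pair_mon2E // fp sp; lia.
by rewrite /T_before !pair_mon2E // fp sp -!(inj_eq val_inj) /=; lia.
Qed.

Variable K : fieldType.

Lemma T_var_anti (a b : 'I_c) : T_var K b a = - T_var K a b.
Proof. by rewrite /T_var opprB. Qed.

Lemma T_var_lt (a b : 'I_c) : (a < b)%N -> T_var K a b = 'X_[pair_mon a b].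
Proof.
move=> /insub_pair_lt[p [_ _ insub_ab insub_ba]].
by rewrite /T_var /T_lt /pair_mon /ordered_pair_mon insub_ab insub_ba subr0 addm0.
Qed.

Lemma T_var_neq (a b : 'I_c) : a != b ->
  exists s : bool, T_var K a b = (-1) ^+ s *: 'X_[pair_mon a b].
Proof.
rewrite ord_neq_ltn => /orP[lt_ab|lt_ba].
  by exists false; rewrite expr0 scale1r T_var_lt.
by exists true; rewrite expr1 scaleN1r T_var_anti pair_monC T_var_lt.
Qed.

End PairMonomials.

Lemma incr4_lt m (u : incr 4 m) :
  [/\ (tnth (val u) 0%R < tnth (val u) 1%R)%N, (tnth (val u) 1%R < tnth (val u) 2%R)%N
    & (tnth (val u) 2%R < tnth (val u) 3%R)%N].
Proof.
case: u => -[[|x0 [|x1 [|x2 [|x3 [|? ?]]]]] // tP] /= /and4P[lt01 lt12 lt23 _].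
by rewrite !(tnth_nth x0).
Qed.

Lemma incr4_ex m (x0 x1 x2 x3 : 'I_m) :
  (x0 < x1)%N -> (x1 < x2)%N -> (x2 < x3)%N ->
  exists u : incr 4 m, [/\ tnth (val u) 0%R = x0, tnth (val u) 1%R = x1,
    tnth (val u) 2%R = x2 & tnth (val u) 3%R = x3].
Proof.
move=> lt01 lt12 lt23.
have inc : sorted ltn [seq nat_of_ord i | i <- [tuple x0; x1; x2; x3]].
  by rewrite /= lt01 lt12 lt23.
by exists (Sub [tuple x0; x1; x2; x3] inc).
Qed.

Lemma incr4_eq m (u v : incr 4 m) :
  tnth (val u) 0%R = tnth (val v) 0%R -> tnth (val u) 1%R = tnth (val v) 1%R ->
  tnth (val u) 2%R = tnth (val v) 2%R -> tnth (val u) 3%R = tnth (val v) 3%R -> u = v.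
Proof.
case: u v => [[[|x0 [|x1 [|x2 [|x3 [|? ?]]]]] // ?] ?].
case=> [[[|y0 [|y1 [|y2 [|y3 [|? ?]]]]] // ?] ?] /=.
rewrite !(tnth_nth x0) /= => e0 e1 e2 e3.
by do 2!apply/val_inj; rewrite /= e0 e1 e2 e3.
Qed.

Section Generators.

Variables (K : fieldType) (d : nat) (n : 'I_d -> nat).
Hypotheses (d_gt0 : (0 < d)%N) (n_gt0 : forall i, (0 < n i)%N).

Local Notation c := (scroll_c n).
Local Notation mon := 'X_{1..fiber_nvars n}.
Local Notation S := {mpoly K[fiber_nvars n]}.
Local Notation lt := (fiber_lt n).
Local Notation next_column := (next_column n d_gt0).

Let ltO : term_order lt := fiber_term_order n.

Let below (l : mon) (f : S) := forall m, m \in msupp f -> lt m l.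

Let belowD l f g : below l f -> below l g -> below l (f + g).
Proof. by move=> ltf ltg m /msuppD_le; rewrite mem_cat => /orP[/ltf|/ltg]. Qed.

Let belowN l f : below l f -> below l (- f).
Proof. by move=> ltf m; rewrite (perm_mem (msuppN f)) => /ltf. Qed.

Lemma T_var_mul (a b u v : 'I_c) : a != b -> u != v ->
  exists s : bool,
    T_var K a b * T_var K u v = (-1) ^+ s *: 'X_[(pair_mon a b + pair_mon u v)%MM].
Proof.
move=> /(T_var_neq K)[s ->] /(T_var_neq K)[s' ->]; exists (s (+) s').
by rewrite mpolyXD -scalerAl -scalerAr scalerA signr_addb.
Qed.

Let below_T_mul l (a b u v : 'I_c) : a != b -> u != v ->
  lt (pair_mon a b + pair_mon u v)%MM l -> below l (T_var K a b * T_var K u v).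
Proof.
move=> /T_var_mul mul_ab /mul_ab[s ->] lt_l m /msuppZ_le.
by rewrite msuppX inE => /eqP->.
Qed.

Lemma T_var_homog (a b : 'I_c) : T_var K a b \is 1.-homog.
Proof.
have [->|/[dup] neq_ab /(T_var_neq K)[s ->]] := eqVneq a b.
  by rewrite /T_var subrr rpred0.
by rewrite rpredZ // dhomogX /= mdeg_pair.
Qed.

Lemma fiber_gens_homog t : fiber_gens n K t \is 2.-homog.
Proof.
by case: t => u; do ![apply: rpredD | rewrite rpredN];
  apply: (dhomogM (d := 1) (e := 1)); apply: T_var_homog.
Qed.

Lemma P_lead (a b g e : 'I_c) : (a < b < g)%N -> (g < e)%N ->
  is_lead lt (P_poly K a b g e) (pair_mon a g + pair_mon b e)%MM.
Proof.
move=> /[dup] abg /andP[ab bg] ge.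
have neq (i j : 'I_c) : (i < j)%N -> i != j by rewrite ord_neq_ltn => ->.
have [ag be ae] : [/\ a < g, b < e & a < e]%N by split; lia.
have -> : P_poly K a b g e = -1 *: 'X_[(pair_mon a g + pair_mon b e)%MM]
    + (T_var K a b * T_var K g e + T_var K a e * T_var K b g).
  by rewrite scaleN1r mpolyXD -!T_var_lt // /P_poly; ring.
apply: lead_of_sum => //; first by rewrite oppr_eq0 oner_eq0.
by apply: belowD; apply: below_T_mul; rewrite ?neq //;
  [apply: fiber_lt_disjoint | apply: fiber_lt_nested].
Qed.

Let overline_lt (a b : 'I_(c - d)) : (a <= b)%N -> (a < overline b)%N.
Proof.
by move=> le_ab; rewrite (overlineE d_gt0) // (leq_ltn_trans le_ab) // ltn_next_column.
Qed.

Let overline_neq (a b : 'I_(c - d)) : (a < b)%N -> overline a != overline b.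
Proof.
move=> lt_ab; apply/eqP => /(congr1 val); rewrite /= !(overlineE d_gt0) //.
by move=> /next_column_inj eq_ab; move: lt_ab; rewrite eq_ab ?ltnn //.
Qed.

Lemma Q_lead (a b g e : 'I_(c - d)) : (a < b < g)%N -> (g < e)%N ->
  is_lead lt (Q_poly K a b g e)
    (pair_mon (widen_col a) (widen_col b)
     + pair_mon (overline g) (overline e))%MM.
Proof.
move=> /[dup] abg /andP[ab bg] ge.
have neq (i j : 'I_c) : (i < j)%N -> i != j by rewrite ord_neq_ltn => ->.
have [ag [be ae]] : (a < g)%N /\ (b < e)%N /\ (a < e)%N by lia.
have [nab nag nae] : [/\ widen_col a != widen_col b, widen_col a != widen_col g
   & widen_col a != widen_col e] by split; apply: neq.
have [nbg nbe nge] : [/\ widen_col b != widen_col g, widen_col b != widen_col e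
   & widen_col g != widen_col e] by split; apply: neq.
have [s lead_s] := T_var_mul nab (overline_neq ge).
rewrite /Q_poly /= -!addrA lead_s; apply: lead_of_sum => //.
  by rewrite signr_eq0.
have [b_lt_g b_lt_e] : (b < overline g)%N /\ (b < overline e)%N.
  by split; apply: overline_lt; lia.
have [b_lt_b a_lt_a] : (b < overline b)%N /\ (a < overline a)%N.
  by split; apply: overline_lt.
have [a_lt_g a_lt_e] : (a < overline g)%N /\ (a < overline e)%N by lia.
have a_lt_b : (a < overline b)%N by lia.
have lead_gap : (widen_col a < widen_col b < overline g)%N by rewrite /= ab.
have below_second := fiber_lt_second lead_gap b_lt_e (overline_neq ge).
have below_first := fiber_lt_first lead_gap b_lt_e (overline_neq ge).
have nge' := overline_neq ge; have nbe' := overline_neq be.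
have nbg' := overline_neq bg; have nae' := overline_neq ae.
have nag' := overline_neq ag; have nab' := overline_neq ab.
apply: belowD; first apply: belowN.
  by apply: (below_T_mul nag nbe');
     apply: below_second (widen_col g) _ _ bg b_lt_b b_lt_e nbe'.
apply: belowD.
  by apply: (below_T_mul nae nbg');
     apply: below_second (widen_col e) _ _ be b_lt_b b_lt_g nbg'.
apply: belowD.
  by apply: (below_T_mul nbg nae');
     apply: below_first (widen_col b) (widen_col g) _ _ ab ag a_lt_a a_lt_e nbg nae'.
apply: belowD; first apply: belowN.
  by apply: (below_T_mul nbe nag');
     apply: below_first (widen_col b) (widen_col e) _ _ ab ae a_lt_a a_lt_g nbe nag'.
by apply: (below_T_mul nge nab');
   apply: below_first (widen_col g) (widen_col e) _ _ ag ae a_lt_a a_lt_b nge nab'.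
Qed.

Definition gen_lead (t : incr 4 c + incr 4 (c - d)) : mon :=
  match t with
  | inl u => (pair_mon (tnth (val u) 0%R) (tnth (val u) 2%R)
              + pair_mon (tnth (val u) 1%R) (tnth (val u) 3%R))%MM
  | inr u => (pair_mon (widen_col (tnth (val u) 0%R)) (widen_col (tnth (val u) 1%R))
              + pair_mon (overline (tnth (val u) 2%R)) (overline (tnth (val u) 3%R)))%MM
  end.

Lemma fiber_gens_lead t : is_lead lt (fiber_gens n K t) (gen_lead t).
Proof.
case: t => u; have [lt01 lt12 lt23] := incr4_lt u.
  by apply: P_lead; rewrite ?lt01.
by apply: Q_lead; rewrite ?lt01.
Qed.

(** The two arcs of a leading monomial, the one that starts first named [p].
    Crossing and separated pairs are told apart by their last condition. *)
Variant gen_lead_spec (p q : incr 2 c) : incr 4 c + incr 4 (c - d) -> Prop :=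
| GenLeadP (u : incr 4 c) of
    fst_idx p = tnth (val u) 0%R & snd_idx p = tnth (val u) 2%R &
    fst_idx q = tnth (val u) 1%R & snd_idx q = tnth (val u) 3%R &
    (fst_idx q < snd_idx p)%N : gen_lead_spec p q (inl u)
| GenLeadQ (u : incr 4 (c - d)) of
    fst_idx p = tnth (val u) 0%R :> nat & snd_idx p = tnth (val u) 1%R :> nat &
    fst_idx q = minn (next_column (tnth (val u) 2%R))
      (next_column (tnth (val u) 3%R)) :> nat &
    snd_idx q = maxn (next_column (tnth (val u) 2%R))
      (next_column (tnth (val u) 3%R)) :> nat &
    (snd_idx p < fst_idx q)%N : gen_lead_spec p q (inr u).

Lemma gen_leadP t : exists p q : incr 2 c,
  [/\ gen_lead t = (U_(enum_rank p) + U_(enum_rank q))%MM,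
      (fst_idx p < fst_idx q)%N & gen_lead_spec p q t].
Proof.
case: t => u; have [lt01 lt12 lt23] := incr4_lt u.
  have [p [fp sp lead_p]] := pair_mon_lt (ltn_trans lt01 lt12).
  have [q [fq sq lead_q]] := pair_mon_lt (ltn_trans lt12 lt23).
  exists p, q; rewrite /= lead_p lead_q fp fq; split=> //.
  by apply: GenLeadP; rewrite // fq sp.
have [p [fp sp lead_p]] := @pair_mon_lt _ n (widen_col (tnth (val u) 0%R))
  (widen_col (tnth (val u) 1%R)) lt01.
have [q [fq sq lead_q]] := pair_mon_neq (overline_neq lt23).
have lt_13 := ltn_trans lt12 lt23.
have := overline_lt (ltnW lt12); have := overline_lt (ltnW lt_13).
move: fq sq; rewrite !(overlineE d_gt0) // => fq sq lt_3 lt_2.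
exists p, q; rewrite /= lead_p lead_q fp fq /=; split=> //.
  by move: lt01 lt_2 lt_3 => /=; lia.
by apply: GenLeadQ; rewrite ?fp ?sp ?fq //=; move: lt_2 lt_3 => /=; lia.
Qed.

Lemma gen_lead_squarefree t : squarefree_mon (gen_lead t).
Proof.
have [p [q [-> lt_pq _]]] := gen_leadP t.
move=> i; rewrite mnmDE !mnm1E; case: eqP => [<-|_]; last by case: eqP.
by rewrite (inj_eq enum_rank_inj); case: eqP lt_pq => [->|]; rewrite ?ltnn.
Qed.

Lemma gen_lead_inj : injective gen_lead.
Proof.
move=> t t'; have [p [q [-> lt_pq spec_t]]] := gen_leadP t.
have [p' [q' [-> lt_pq' spec_t']]] := gen_leadP t'.
move=> /mnmP eq_m.
have eqE r : ((p == r) + (q == r) = (p' == r) + (q' == r))%N.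
  by have := eq_m (enum_rank r); rewrite !mnmDE !mnm1E !(inj_eq enum_rank_inj).
have [eq_p eq_q] : p = p' /\ q = q'.
  have p_in : (p' == p) || (q' == p).
    by have := eqE p; rewrite eqxx; case: (p' == p); case: (q' == p).
  have q_in : (p' == q) || (q' == q).
    by have := eqE q; rewrite eqxx addn1; case: (p' == q); case: (q' == q).
  case/orP: p_in => /eqP eq_p; case/orP: q_in => /eqP eq_q //.
  - by move: lt_pq; rewrite -eq_p eq_q ltnn.
  - by move: lt_pq; rewrite -eq_p -eq_q; lia.
  - by move: lt_pq; rewrite -eq_p eq_q ltnn.
case: spec_t spec_t' => u; rewrite eq_p eq_q => e0 e1 e2 e3 lt_qp;
  case=> u' e0' e1' e2' e3' lt_qp'.
- congr inl; apply: incr4_eq; by rewrite -?e0 -?e1 -?e2 -?e3.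
- by lia.
- by lia.
congr inr.
have [_ _ lt23] := incr4_lt u; have [_ _ lt23'] := incr4_lt u'.
have [eq2 eq3] : tnth (val u) 2%R = tnth (val u') 2%R /\
                 tnth (val u) 3%R = tnth (val u') 3%R.
  have nextI (a b : 'I_(c - d)) : next_column a = next_column b -> a = b.
    by move=> eq_ab; apply: val_inj; apply: (next_column_inj n_gt0 _ _ eq_ab).
  have [[/nextI eq2 /nextI eq3]|[/nextI eq2 /nextI eq3]] :
    (next_column (tnth (val u) 2%R) = next_column (tnth (val u') 2%R) /\
     next_column (tnth (val u) 3%R) = next_column (tnth (val u') 3%R)) \/
    (next_column (tnth (val u) 2%R) = next_column (tnth (val u') 3%R) /\
     next_column (tnth (val u) 3%R) = next_column (tnth (val u') 2%R)) by lia.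
    by [].
  by rewrite eq2 eq3 in lt23; lia.
by apply: incr4_eq => //; apply: val_inj; rewrite /= -?e0 -?e1.
Qed.

(** * Vanishing of the generators *)

Local Notation top a := (scroll_matrix n K ord0 a).
Local Notation bot a := (scroll_matrix n K ord_max a).

Lemma topE (a : 'I_c) : top a = x_var n K (column n d_gt0 a).1 (column n d_gt0 a).2.
Proof.
rewrite mxE (nth_map (Ordinal d_gt0, 0%N)) ?size_scroll_columns //.
by rewrite addn0.
Qed.

Lemma botE (a : 'I_c) : bot a = x_var n K (column n d_gt0 a).1 (column n d_gt0 a).2.+1.
Proof.
rewrite mxE (nth_map (Ordinal d_gt0, 0%N)) ?size_scroll_columns //.
by rewrite addn1.
Qed.

Lemma top_overline (a : 'I_(c - d)) : top (overline a) = bot (widen_col a).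
Proof.
by rewrite topE botE (overlineE d_gt0) // column_next.
Qed.

Lemma g_minorE (p : incr 2 c) :
  fiber_Pi ('X_(enum_rank p) : S) = g_minor K (fst_idx p) (snd_idx p).
Proof. by rewrite /fiber_Pi comp_mpolyXU -tnth_nth tnth_mktuple enum_rankK. Qed.

Lemma Pi_T_var (a b : 'I_c) : fiber_Pi (T_var K a b) = g_minor K a b.
Proof.
have Pi_lt (i j : 'I_c) : (i < j)%N -> fiber_Pi (T_var K i j) = g_minor K i j.
  move=> lt_ij; have [p [<- <- eq_p]] := pair_mon_lt lt_ij.
  by rewrite T_var_lt ?fst_lt_snd // pair_mon_idx g_minorE.
case: (ltngtP a b) => [/Pi_lt //|lt_ba|/val_inj->].
  by rewrite T_var_anti /fiber_Pi comp_mpolyN -/(fiber_Pi _) Pi_lt // /g_minor; ring.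
by rewrite /T_var subrr /fiber_Pi comp_mpoly0 /g_minor subrr.
Qed.

(** The six terms of [Q] are the Laplace expansion, along the first two rows,
    of the determinant of four columns of the four-rowed matrix that stacks
    the columns [a] and [overline a]; two of its rows coincide after the
    substitution. *)
Lemma fiber_gens_in_ideal t : fiber_ideal n K (fiber_gens n K t).
Proof.
rewrite /fiber_ideal; case: t => u; rewrite /fiber_Pi /= /P_poly /Q_poly;
  rewrite !(comp_mpolyD, comp_mpolyN, rmorphM) /= -!/(fiber_Pi _) !Pi_T_var /g_minor.
  by ring.
by rewrite !top_overline; ring.
Qed.

End Generators.

(** * Standard monomials *)

Section Standard.

Variables (d : nat) (n : 'I_d -> nat).
Hypotheses (d_gt0 : (0 < d)%N) (n_gt0 : forall i, (0 < n i)%N).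

Local Notation c := (scroll_c n).
Local Notation mon := 'X_{1..fiber_nvars n}.
Local Notation next_column := (next_column n d_gt0).

Variable m : mon.
Hypothesis std_m : standard (@gen_lead d n) m.

Let exp (p : incr 2 c) := m (enum_rank p).

Let not_lead t p q : gen_lead t = (U_(enum_rank p) + U_(enum_rank q))%MM ->
  p != q -> (0 < exp p)%N -> (0 < exp q)%N -> False.
Proof.
move=> lead_t neq_pq m_p m_q; have /forallP/(_ t)/negP := std_m; apply.
rewrite lead_t; apply/mnm_lepP => i; rewrite mnmDE !mnm1E.
case: eqP => [<-|_]; last by case: eqP => [<-|].
by rewrite (inj_eq enum_rank_inj) eq_sym (negPf neq_pq).
Qed.

Lemma standard_noncrossing p q : (0 < exp p)%N -> (0 < exp q)%N ->
  ~~ [&& fst_idx p < fst_idx q, fst_idx q < snd_idx p & snd_idx p < snd_idx q]%N.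
Proof.
move=> m_p m_q; apply/negP => /and3P[lt_f lt_fs lt_s].
have [u [u0 u1 u2 u3]] := incr4_ex lt_f lt_fs lt_s.
apply: (not_lead (t := inl u) _ _ m_p m_q).
  by rewrite /= u0 u1 u2 u3 !pair_mon_idx.
by apply: contraTneq lt_f => ->; rewrite ltnn.
Qed.

Lemma standard_gap p q a b : (0 < exp p)%N -> (0 < exp q)%N ->
  (snd_idx p < a < c - d)%N -> (snd_idx p < b < c - d)%N ->
  (fst_idx q = next_column a :> nat) -> (snd_idx q = next_column b :> nat) -> False.
Proof.
move=> m_p m_q /andP[lt_pa lt_a] /andP[lt_pb lt_b] fq sq.
have lt_p := fst_lt_snd p; have lt_q := fst_lt_snd q.
have lt_s : (snd_idx p < c - d)%N by lia.
have lt_f : (fst_idx p < c - d)%N by lia.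
have pairE : pair_mon (overline (Ordinal lt_a)) (overline (Ordinal lt_b))
             = U_(enum_rank q)%MM :> mon.
  rewrite -pair_mon_idx; congr pair_mon; apply: val_inj.
    by rewrite /= (overlineE d_gt0) // fq.
  by rewrite /= (overlineE d_gt0) // sq.
have pairE' : pair_mon (widen_col (Ordinal lt_f)) (widen_col (Ordinal lt_s))
             = U_(enum_rank p)%MM :> mon.
  by rewrite -pair_mon_idx; congr pair_mon; apply: val_inj.
have neq_pq : p != q.
  apply/eqP => eq_pq; have := ltn_next_column d_gt0 n_gt0 lt_a; rewrite -fq.
  by move: lt_pa lt_q; rewrite eq_pq; lia.
have neq_ab : a <> b by move=> eq_ab; move: lt_q; rewrite fq sq eq_ab ltnn.
case: (ltngtP a b) => // lt_ab.
  have [u [u0 u1 u2 u3]] := @incr4_ex _ (Ordinal lt_f) (Ordinal lt_s)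
    (Ordinal lt_a) (Ordinal lt_b) lt_p lt_pa lt_ab.
  by apply: (not_lead (t := inr u) _ neq_pq m_p m_q); rewrite /= u0 u1 u2 u3 pairE pairE'.
have [u [u0 u1 u2 u3]] := @incr4_ex _ (Ordinal lt_f) (Ordinal lt_s)
  (Ordinal lt_b) (Ordinal lt_a) lt_p lt_pb lt_ab.
apply: (not_lead (t := inr u) _ neq_pq m_p m_q).
by rewrite /= u0 u1 u2 u3 [pair_mon (overline _) _]pair_monC pairE pairE'.
Qed.

End Standard.

(** * Noncrossing matchings *)

Section Noncrossing.

Variables (E : finType) (lo hi : E -> nat) (h : nat).
Hypothesis lo_hi : forall e, (lo e < hi e)%N.
Hypothesis arc_inj : forall e e', lo e = lo e' -> hi e = hi e' -> e = e'.

Local Open Scope nat_scope.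

(** Think of the points below [h] as listed from left to right on the upper side
    of a strip, and of the others as listed from right to left on its lower
    side.  Arcs are directed from left to right; those from the upper to the
    lower side start above.  Noncrossing arcs on a circle remain so in the
    strip, but the left-to-right order is not the order of the labels. *)
Definition opener (e : E) := if h <= lo e then hi e else lo e.
Definition closer (e : E) := if h <= lo e then lo e else hi e.

Definition crossing (e e' : E) := [&& lo e < lo e', lo e' < hi e & hi e < hi e'].

Section Exchange.

(** Two systems of arcs, named by a boolean, without a common arc and with the
    same openers and the same closers. *)
Variable N : bool -> pred E.
Hypothesis N_disj : forall b e, N b e -> ~~ N (~~ b) e.
Hypothesis N_opener : forall b e, N b e -> exists2 e', N (~~ b) e' & opener e' = opener e.
Hypothesis N_closer : forall b e, N b e -> exists2 e', N (~~ b) e' & closer e' = closer e.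
Hypothesis N_noncrossing : forall b e e', N b e -> N b e' -> ~~ crossing e e'.

Let partners b e : N b e -> exists e1 e2,
  [/\ N (~~ b) e1, N (~~ b) e2, opener e1 = opener e, closer e2 = closer e &
   ~~ crossing e1 e2 && ~~ crossing e2 e1].
Proof.
move=> Ne; have [e1 N1 op1] := N_opener Ne; have [e2 N2 cl2] := N_closer Ne.
by exists e1, e2; split; rewrite ?(N_noncrossing N1) ?(N_noncrossing N2).
Qed.

Let neq_arc b e e' : N b e -> N (~~ b) e' -> lo e = lo e' -> hi e = hi e' -> False.
Proof. by move=> Ne + eq_lo eq_hi; rewrite -(arc_inj eq_lo eq_hi); apply/negP/N_disj. Qed.

(** The argument of this lemma and the next two: let [e] be a shortest arc of its
    kind.  The arcs [e1] and [e2] of the other system through its opener and its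
    closer cannot be shorter; they leave [e] on opposite sides and cross. *)
Let no_low k b e : hi e < h -> hi e - lo e <= k -> N b e -> False.
Proof.
elim: k b e => [|k IHk] b e lt_h le_k Ne; have lt_e := lo_hi e; first by lia.
have [e1 [e2 [N1 N2 op1 cl2 /andP[nc12 nc21]]]] := partners Ne.
have [lt1 lt2] := (lo_hi e1, lo_hi e2).
have low1 : hi e1 < h -> hi e1 - lo e1 <= k -> False by move=> *; apply: IHk N1.
have low2 : hi e2 < h -> hi e2 - lo e2 <= k -> False by move=> *; apply: IHk N2.
have neq1 := neq_arc Ne N1; have neq2 := neq_arc Ne N2.
move: op1 cl2 nc21; rewrite /opener /closer /crossing.
have -> : (h <= lo e) = false by lia.
by case: (leqP h (lo e1)) => h1; case: (leqP h (lo e2)) => h2 /= op1 cl2 nc21; lia.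
Qed.

Let no_high k b e : h <= lo e -> hi e - lo e <= k -> N b e -> False.
Proof.
elim: k b e => [|k IHk] b e le_h le_k Ne; have lt_e := lo_hi e; first by lia.
have [e1 [e2 [N1 N2 op1 cl2 /andP[nc12 nc21]]]] := partners Ne.
have [lt1 lt2] := (lo_hi e1, lo_hi e2).
have high1 : h <= lo e1 -> hi e1 - lo e1 <= k -> False by move=> *; apply: IHk N1.
have high2 : h <= lo e2 -> hi e2 - lo e2 <= k -> False by move=> *; apply: IHk N2.
have neq1 := neq_arc Ne N1; have neq2 := neq_arc Ne N2.
move: op1 cl2 nc21 nc12; rewrite /opener /closer /crossing le_h.
by case: (leqP h (lo e1)) => h1; case: (leqP h (lo e2)) => h2 /= op1 cl2 nc21 nc12; lia.
Qed.

Let no_across k b e : lo e < h -> h <= hi e -> hi e - lo e <= k -> N b e -> False.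
Proof.
elim: k b e => [|k IHk] b e lt_h le_h le_k Ne; have lt_e := lo_hi e; first by lia.
have [e1 [e2 [N1 N2 op1 cl2 /andP[nc12 nc21]]]] := partners Ne.
have [lt1 lt2] := (lo_hi e1, lo_hi e2).
have [low1 low2] : ~ hi e1 < h /\ ~ hi e2 < h.
  by split=> ?; [apply: (no_low _ _ N1) | apply: (no_low _ _ N2)].
have [high1 high2] : ~ h <= lo e1 /\ ~ h <= lo e2.
  by split=> ?; [apply: (no_high _ _ N1) | apply: (no_high _ _ N2)].
have across1 : lo e1 < h -> h <= hi e1 -> hi e1 - lo e1 <= k -> False.
  by move=> *; apply: IHk N1.
have across2 : lo e2 < h -> h <= hi e2 -> hi e2 - lo e2 <= k -> False.
  by move=> *; apply: IHk N2.
have neq1 := neq_arc Ne N1; have neq2 := neq_arc Ne N2.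
move: op1 cl2 nc21; rewrite /opener /closer /crossing.
have -> : (h <= lo e) = false by lia.
have -> : (h <= lo e1) = false by lia.
have -> : (h <= lo e2) = false by lia.
by move=> /= op1 cl2; lia.
Qed.

Lemma no_exchange b e : ~~ N b e.
Proof.
apply/negP => Ne; have [lt_h|le_h] := ltnP (hi e) h; first exact: no_low Ne.
by have [lt_h|le_h'] := ltnP (lo e) h; [apply: no_across Ne | apply: no_high Ne].
Qed.

End Exchange.

(** After the common part of the two systems is cancelled, no arc is left. *)
Lemma noncrossing_matching_unique (m m' : E -> nat) :
  (forall e e', 0 < m e -> 0 < m e' -> ~~ crossing e e') ->
  (forall e e', 0 < m' e -> 0 < m' e' -> ~~ crossing e e') ->
  (forall u, \sum_(e | opener e == u) m e = \sum_(e | opener e == u) m' e) ->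
  (forall u, \sum_(e | closer e == u) m e = \sum_(e | closer e == u) m' e) ->
  m =1 m'.
Proof.
move=> nc nc' eq_op eq_cl.
(* The sign of the difference of the multiplicities is all that matters. *)
pose N (b : bool) e := if b then m e < m' e else m' e < m e.
have ex_more (P : pred E) (f g : E -> nat) e0 :
    P e0 -> f e0 < g e0 -> \sum_(e | P e) f e = \sum_(e | P e) g e ->
  exists2 e, g e < f e & P e.
  move=> Pe0 lt_fg eq_sum; have [e /andP[Pe lt_gf]|le_fg] := pickP (fun e => P e && (g e < f e)).
    by exists e.
  move/eqP: eq_sum; rewrite (bigD1 e0) // [X in _ == X](bigD1 e0) //=.
  rewrite ltn_eqF // -addSn leq_add // leq_sum // => e /andP[Pe _].
  by have /negbT := le_fg e; rewrite Pe /= -leqNgt.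
have no_N b e : ~~ N b e.
  apply: (no_exchange (N := N)) => [[] e1|[] e1 lt1|[] e1 lt1|[] e1 e2] /=; rewrite /N.
  - by lia.
  - by lia.
  - have [e2 lt2 /eqP] := ex_more _ _ _ _ (eqxx (opener e1)) lt1 (eq_op _).
    by exists e2.
  - have [e2 lt2 /eqP] := ex_more _ _ _ _ (eqxx (opener e1)) lt1 (esym (eq_op _)).
    by exists e2.
  - have [e2 lt2 /eqP] := ex_more _ _ _ _ (eqxx (closer e1)) lt1 (eq_cl _).
    by exists e2.
  - have [e2 lt2 /eqP] := ex_more _ _ _ _ (eqxx (closer e1)) lt1 (esym (eq_cl _)).
    by exists e2.
  - by move=> lt1 lt2; apply: nc'; lia.
  - by move=> lt1 lt2; apply: nc; lia.
by move=> e; have := no_N true e; have := no_N false e; rewrite /N; lia.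
Qed.

End Noncrossing.

(** * Weights *)

Section Weights.

Variables (K : fieldType) (N : nat).

Definition mon_weight (w : 'I_N -> nat) (q : 'X_{1..N}) : nat := (\sum_i q i * w i)%N.

Lemma mon_weightD w q q' : mon_weight w (q + q')%MM = (mon_weight w q + mon_weight w q')%N.
Proof. by rewrite -big_split; apply: eq_bigr => i _; rewrite mnmDE mulnDl. Qed.

Lemma mon_weight0 w : mon_weight w 0%MM = 0%N.
Proof. by rewrite /mon_weight big1 // => i _; rewrite mnm0E. Qed.

Lemma mon_weightU w i : mon_weight w U_(i)%MM = w i.
Proof.
rewrite /mon_weight (bigD1 i) //= mnm1E eqxx mul1n big1 ?addn0 // => j ne_ji.
by rewrite mnm1E eq_sym (negPf ne_ji).
Qed.

Definition weight_at_most w (f : {mpoly K[N]}) t :=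
  forall q, q \in msupp f -> (mon_weight w q <= t)%N.

Lemma weight_at_most1 w : weight_at_most w 1 0.
Proof. by move=> q; rewrite msupp1 inE => /eqP->; rewrite mon_weight0. Qed.

Lemma weight_at_mostM w f g s t : weight_at_most w f s -> weight_at_most w g t ->
  weight_at_most w (f * g) (s + t).
Proof.
move=> le_f le_g q /msuppM_le/allpairsP[[q1 q2] /= [/le_f le1 /le_g le2 ->]].
by rewrite mon_weightD leq_add.
Qed.

Lemma weight_at_mostX w f t k : weight_at_most w f t ->
  weight_at_most w (f ^+ k) (k * t).
Proof.
move=> le_f; elim: k => [|k IHk]; first by rewrite expr0; apply: weight_at_most1.
by rewrite exprS mulSn; apply: weight_at_mostM.
Qed.

Variables v w : 'I_N -> nat.

Definition weight_lt (q q' : 'X_{1..N}) : bool :=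
  (mon_weight v q < mon_weight v q')%N
  || (mon_weight v q == mon_weight v q') && (mon_weight w q < mon_weight w q')%N.

(** Stated as a decomposition of [f], the form that passes to products. *)
Definition weight_lead (f : {mpoly K[N]}) (l : 'X_{1..N}) :=
  exists a g, [/\ a != 0, f = a *: 'X_[l] + g
                & forall q, q \in msupp g -> weight_lt q l].

Lemma weight_lead1 : weight_lead 1 0%MM.
Proof.
exists 1, 0; split; first exact: oner_neq0.
  by rewrite scale1r addr0 mpolyX0.
by move=> q; rewrite msupp0.
Qed.

Lemma weight_leadM f g l k :
  weight_lead f l -> weight_lead g k -> weight_lead (f * g) (l + k)%MM.
Proof.
move=> [a [f' [a0 -> lt_f]]] [b [g' [b0 -> lt_g]]].
exists (a * b), ((a *: 'X_[l] + f') * g' + f' * (b *: 'X_[k])); split.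
- by rewrite mulf_neq0.
- have -> : (a * b) *: 'X_[(l + k)] = (a *: 'X_[l]) * (b *: 'X_[k]) :> {mpoly K[N]}.
    by rewrite mpolyXD -scalerAl -scalerAr scalerA.
  by move: (a *: _) (b *: _) => x y; ring.
move=> q /msuppD_le; rewrite mem_cat => /orP[] /msuppM_le/allpairsP[[q1 q2] /=].
  move=> [/msuppD_le + /lt_g + ->]; rewrite mem_cat => /orP[/msuppZ_le|/lt_f].
    rewrite msuppX inE => /eqP->; rewrite /weight_lt !mon_weightD; lia.
  by rewrite /weight_lt !mon_weightD; lia.
move=> [/lt_f + /msuppZ_le + ->]; rewrite msuppX inE => + /eqP->.
by rewrite /weight_lt !mon_weightD; lia.
Qed.

Lemma weight_leadX f l k : weight_lead f l -> weight_lead (f ^+ k) (l *+ k)%MM.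
Proof.
move=> lead_f; elim: k => [|k IHk]; first by rewrite expr0 mulm0n; apply: weight_lead1.
by rewrite exprS mulmS; apply: weight_leadM.
Qed.

Lemma weight_lead_coeff f l : weight_lead f l -> f@_l != 0.
Proof.
move=> [a [g [a0 -> lt_g]]]; rewrite mcoeffD mcoeffZ mcoeffX eqxx mulr1.
rewrite [g@_l]memN_msupp_eq0 ?addr0 //; apply/negP => /lt_g.
by rewrite /weight_lt ltnn ltnn andbF.
Qed.

Lemma weight_lead_msupp f l q : weight_lead f l -> q \in msupp f ->
  q = l \/ weight_lt q l.
Proof.
move=> [a [g [a0 -> lt_g]]] /msuppD_le; rewrite mem_cat.
case/orP=> [/msuppZ_le|/lt_g]; last by right.
by rewrite msuppX inE => /eqP; left.
Qed.

End Weights.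

(** * Degenerations of the scroll *)

Section Degeneration.

Variables (d : nat) (n : 'I_d -> nat).
Hypotheses (d_gt0 : (0 < d)%N) (n_gt0 : forall i, (0 < n i)%N).
Hypothesis n_homo : forall i j : 'I_d, (i <= j)%N -> (n i <= n j)%N.

Local Notation c := (scroll_c n).
Local Notation column := (column n d_gt0).
Local Notation column_index := (@column_index d n).
Local Notation next_column := (next_column n d_gt0).
Local Open Scope nat_scope.

Variable B : nat.

(** Base two makes the drop from a column to its successor decrease along the
    columns, see [weight_drop]. *)
Definition column_weight (u : nat) := 2 ^ (c - u).
Local Notation W := column_weight.

(** A weight given to all of the first row.  For this value the entry shared by
    the column [B] and its successor has the full weight in both. *)
Definition row_shift := if B < c - d then W B - W (next_column B) else 0.
Local Notation M := row_shift.

(** The columns whose bottom, respectively top, entry is negligible. *)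
Definition early (u : nat) := (u < B) && (u < c - d).
Definition late (u : nat) := [exists a : 'I_(c - d), (B < a) && (next_column a == u)].

Lemma lateP u : reflect (exists2 a, B < a < c - d & next_column a = u) (late u).
Proof.
apply: (iffP existsP) => [[a /andP[lt_a /eqP eq_a]]|[a /andP[lt_Ba lt_a] eq_a]].
  by exists (nat_of_ord a); rewrite ?lt_a /=.
by exists (Ordinal lt_a); rewrite lt_Ba /= eq_a eqxx.
Qed.

(** The threshold at which the order of the columns turns: the first late
    column, or [c] if there is none.  Early columns open arcs only and late ones
    close arcs only, so the former have to come first and the latter last. *)
Lemma late_bound : exists h, [/\ forall u, late u -> h <= u,
  forall u v, h <= u -> u < v -> late v -> late u &
  forall u, u < c -> early u -> u < h].
Proof.
have [/existsP[a0 lt_a0]|noD] := boolP [exists a : 'I_(c - d), B < a]; last first.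
  have nolate u : late u = false.
    apply/negbTE; apply: contra noD => /existsP[a /andP[lt_a _]].
    by apply/existsP; exists a.
  by exists c; split=> // [u|u v _ _]; rewrite nolate.
have ex_late : exists u, late u.
  by exists (next_column a0); apply/lateP; exists a0; rewrite ?lt_a0 /=.
case: (ex_minnP ex_late) => h late_h min_h; exists h; split=> // [u v le_hu lt_uv late_v|u _].
  have [<- //|neq_hu] := eqVneq h u; apply/lateP.
  case/lateP: late_h => a /andP[Ba ac] eq_a; case/lateP: late_v => b /andP[Bb bc] eq_b.
  by apply: (next_convex n_gt0 n_homo Ba ac Bb bc); rewrite ?eq_a ?eq_b //; lia.
case/andP=> ltB _; case/lateP: late_h => a /andP[Ba ac] <-.
by have := ltn_next_column d_gt0 n_gt0 ac; lia.
Qed.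

Lemma column_weight_half u v : u < v -> v <= c -> W v + W v <= W u.
Proof.
move=> lt_uv le_v; rewrite /W addnn -mul2n -expnS leq_pexp2l //; lia.
Qed.

Lemma column_weight_gt0 u : 0 < W u. Proof. by rewrite expn_gt0. Qed.

(** The weights halve from one column to the next, so that the drop
    [W a - W (next a)] decreases with [a]: one shift of the first row separates
    the indices before [B] from those after [B]. *)
Lemma weight_drop a b : a < b -> b < c - d ->
  W b + W (next_column a) < W a + W (next_column b).
Proof.
move=> lt_ab lt_b; have lt_a : a < c - d by lia.
have := column_weight_half lt_ab; have := column_weight_half (ltn_next_column d_gt0 n_gt0 lt_a).
have := next_column_lt d_gt0 n_gt0 lt_a; have := column_weight_gt0 (next_column b).
by move: (W b) (W a) (W (next_column a)) (W (next_column b)) => *; lia.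
Qed.

Lemma weight_next a : a < c - d -> W (next_column a) < W a.
Proof.
move=> lt_a; have := column_weight_half (ltn_next_column d_gt0 n_gt0 lt_a).
have := next_column_lt d_gt0 n_gt0 lt_a; have := column_weight_gt0 (next_column a).
by move: (W a) (W (next_column a)) => *; lia.
Qed.

Lemma shift_before a : a < c - d -> a < B -> W (next_column a) + M < W a.
Proof.
move=> lt_a lt_aB; have := weight_next lt_a; rewrite /M.
case: (ltnP B (c - d)) => [lt_B|_]; last by rewrite addn0.
have := weight_drop lt_aB lt_B; have := weight_next lt_B.
by move: (W a) (W B) (W (next_column a)) (W (next_column B)) => *; lia.
Qed.

Lemma shift_after a : a < c - d -> B < a -> W a < W (next_column a) + M.
Proof.
move=> lt_a lt_Ba; have lt_B : B < c - d by lia.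
have := weight_drop lt_Ba lt_a; have := weight_next lt_B; rewrite /M lt_B.
by move: (W a) (W B) (W (next_column a)) (W (next_column B)) => *; lia.
Qed.

Lemma shift_at : B < c - d -> W (next_column B) + M = W B.
Proof. by move=> lt_B; rewrite /M lt_B; have := weight_next lt_B; lia. Qed.

(** The least of the weights that the columns with top, respectively bottom,
    entry [x_(i,j)] ask for; the ends of a block are asked for one weight only. *)
Definition entry_weight (i : 'I_d) (j : nat) : nat :=
  if j == 0 then W (column_index (i, j)) + M
  else if j == n i then W (column_index (i, j.-1))
  else minn (W (column_index (i, j)) + M) (W (column_index (i, j.-1))).

Lemma top_weight u : u < c ->
  entry_weight (column u).1 (column u).2 <= W u + M ?= iff ~~ late u.
Proof.
set e := entry_weight _ _ => lt_u; suff : if late u then is_true (e < W u + M) else e = W u + M.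
  by case: (late u) => [lt_e|->]; split; rewrite ?eqxx ?ltn_eqF // ltnW.
rewrite {}/e; have lt_j := mem_column d_gt0 n_gt0 lt_u.
have idx_u : column_index ((column u).1, (column u).2) = u.
  by rewrite -surjective_pairing columnK.
rewrite /entry_weight idx_u; case: eqVneq => [j0|j0].
  case: ifP => // /lateP[a /andP[_ lt_a] eq_a].
  by move: j0; rewrite -eq_a column_next.
rewrite ltn_eqF //; have [|a lt_a [eq_a col_a]] := column_next_exists (d_gt0 := d_gt0) n_gt0 lt_u.
  by rewrite lt0n.
have -> : column_index ((column u).1, (column u).2.-1) = a.
  by rewrite -col_a columnK //; lia.
rewrite -eq_a; case: ifP => [/lateP[b /andP[lt_Bb lt_b]]|not_late].
  move=> eq_b; have eq_ab := next_column_inj n_gt0 lt_b lt_a eq_b.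
  by have := shift_after lt_a; rewrite -eq_ab => /(_ lt_Bb); lia.
have le_aB : a <= B.
  rewrite leqNgt; apply/negP => lt_Ba; move/lateP: not_late; apply.
  by exists a; rewrite ?lt_Ba.
apply/minn_idPl; case: (ltngtP a B) le_aB => // [lt_aB|eq_aB] _.
  exact/ltnW/shift_before.
by rewrite eq_aB shift_at // -eq_aB.
Qed.

Lemma bot_weight u : u < c ->
  entry_weight (column u).1 (column u).2.+1 <= W u ?= iff ~~ early u.
Proof.
set e := entry_weight _ _ => lt_u; suff : if early u then is_true (e < W u) else e = W u.
  by case: (early u) => [lt_e|->]; split; rewrite ?eqxx ?ltn_eqF // ltnW.
rewrite {}/e; have lt_j := mem_column d_gt0 n_gt0 lt_u.
have idx_u : column_index ((column u).1, (column u).2) = u.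
  by rewrite -surjective_pairing columnK.
rewrite /entry_weight /= idx_u; have := inner_column d_gt0 n_gt0 lt_u.
rewrite /inner; case: eqVneq => [j0|j0] inn; rewrite /early -inn.
  by rewrite j0 ltnn andbF.
have -> : (column u).2.+1 < n (column u).1 by rewrite ltn_neqAle j0.
have lt_u' : u < c - d by rewrite -inn ltn_neqAle j0.
rewrite -[column_index _]/(next_column u) andbT.
case: (ltngtP u B) => [lt_uB|lt_Bu|eq_uB].
- by have := shift_before lt_u' lt_uB; lia.
- by apply/minn_idPr/ltnW/shift_after.
- by apply/minn_idPr; rewrite eq_uB shift_at // -eq_uB.
Qed.

Local Notation fst_col := (fun p : incr 2 c => fst_idx p : nat).
Local Notation snd_col := (fun p : incr 2 c => snd_idx p : nat).
Local Notation mon := 'X_{1..fiber_nvars n}.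
Local Notation x_index := {i : 'I_d & 'I_(n i).+1}.

Definition x_rank (i : 'I_d) (j : nat) : 'I_#|{: x_index}| :=
  enum_rank (Tagged (fun i => 'I_(n i).+1) (inord j : 'I_(n i).+1)).

Definition x_top u := x_rank (column u).1 (column u).2.
Definition x_bot u := x_rank (column u).1 (column u).2.+1.

Definition on_x (f : 'I_d -> nat -> nat) (k : 'I_#|{: x_index}|) : nat :=
  f (tag (enum_val k)) (tagged (enum_val k)).

Lemma on_xE f i j : j <= n i -> on_x f (x_rank i j) = f i j.
Proof. by move=> le_j; rewrite /on_x enum_rankK /= inordK. Qed.

Lemma x_rank_inj i j i' j' : j <= n i -> j' <= n i' ->
  x_rank i j = x_rank i' j' -> (i, j) = (i', j').
Proof.
move=> le_j le_j' eq_x.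
have := on_xE (fun i _ => nat_of_ord i) le_j; rewrite eq_x on_xE // => /val_inj eq_i.
by have := on_xE (fun _ j => j) le_j; rewrite eq_x on_xE // => <-; rewrite eq_i.
Qed.

Lemma x_top_bound u : u < c -> (column u).2 <= n (column u).1.
Proof. by move=> /(mem_column d_gt0 n_gt0)/ltnW. Qed.

Lemma x_bot_bound u : u < c -> (column u).2.+1 <= n (column u).1.
Proof. exact: mem_column. Qed.

Lemma x_top_eq u v : u < c -> v < c -> (x_top u == x_top v) = (u == v).
Proof.
move=> lt_u lt_v; apply/eqP/eqP => [|->//].
move/(x_rank_inj (x_top_bound lt_u) (x_top_bound lt_v)).
rewrite -!surjective_pairing => eq_col.
by rewrite -(columnK d_gt0 n_gt0 lt_u) eq_col columnK.
Qed.

Lemma x_bot_eq u v : u < c -> v < c -> (x_bot u == x_bot v) = (u == v).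
Proof.
move=> lt_u lt_v; apply/eqP/eqP => [|->//].
move/(x_rank_inj (x_bot_bound lt_u) (x_bot_bound lt_v)) => -[eq1 eq2].
rewrite -(columnK d_gt0 n_gt0 lt_u) [column u]surjective_pairing eq1 eq2.
by rewrite -surjective_pairing columnK.
Qed.

Lemma x_top_bot_eq u v : u < c -> v < c ->
  (x_top u == x_bot v) = (v < c - d) && (u == next_column v).
Proof.
move=> lt_u lt_v; apply/eqP/andP => [|[lt_v' /eqP->]]; last by rewrite /x_top column_next.
move/(x_rank_inj (x_top_bound lt_u) (x_bot_bound lt_v)); rewrite -surjective_pairing => eq_u.
have in_u := mem_column d_gt0 n_gt0 lt_u.
split; first by rewrite -(inner_column d_gt0 n_gt0) // /inner; rewrite eq_u in in_u.
by rewrite /next_column /scroll_shift -eq_u columnK.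
Qed.

Local Notation v := (on_x entry_weight).

Lemma entry_weight_pair a b : a < c -> b < c ->
  mon_weight v (U_(x_top a) + U_(x_bot b))%MM <= W a + M + W b
    ?= iff ~~ late a && ~~ early b.
Proof.
move=> lt_a lt_b; rewrite mon_weightD !mon_weightU !on_xE ?x_top_bound ?x_bot_bound //.
exact: leqif_add (top_weight lt_a) (bot_weight lt_b).
Qed.

(** The variables that do not degenerate to zero for the cut [B]. *)
Definition allowed (p : incr 2 c) : bool :=
  ~~ (early (fst_idx p) && early (snd_idx p))
  && ~~ (late (fst_idx p) && late (snd_idx p)).

Definition mon_allowed (m : mon) : bool :=
  [forall p : incr 2 c, (0 < m (enum_rank p)) ==> allowed p].

Definition column_degree (m : mon) : nat :=
  \sum_(p : incr 2 c) m (enum_rank p) * (W (fst_idx p) + W (snd_idx p)).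

Lemma mdeg_pairs (m : mon) : mdeg m = \sum_(p : incr 2 c) m (enum_rank p).
Proof. by rewrite mdegE (reindex _ (onW_bij _ (@enum_rank_bij _))). Qed.

Lemma column_degree_shift (m : mon) :
  \sum_(p : incr 2 c) m (enum_rank p) * (W (fst_idx p) + W (snd_idx p) + M)
  = column_degree m + mdeg m * M.
Proof.
rewrite mdeg_pairs big_distrl -big_split /=.
by apply: eq_bigr => p _; rewrite mulnDr.
Qed.

Section Minors.

Variable K : fieldType.

Lemma g_minor_mon (a b : 'I_c) : g_minor K a b
  = ('X_[U_(x_top a) + U_(x_bot b)] - 'X_[U_(x_top b) + U_(x_bot a)])%R.
Proof.
by rewrite /g_minor !(topE K d_gt0 n_gt0) !(botE K d_gt0 n_gt0) /x_var -!mpolyXD.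
Qed.

Lemma g_minor_weight (p : incr 2 c) :
  weight_at_most v (g_minor K (fst_idx p) (snd_idx p))
    (W (fst_idx p) + W (snd_idx p) + M - ~~ allowed p).
Proof.
have le_t a b : a < c -> b < c ->
    ~~ allowed p ==> ~~ (~~ late a && ~~ early b) ->
  mon_weight v (U_(x_top a) + U_(x_bot b))%MM <= W a + W b + M - ~~ allowed p.
  move=> lt_a lt_b excl; have [le_w eq_w] := entry_weight_pair lt_a lt_b.
  have [_|nall_p] := boolP (allowed p); first by rewrite subn0; lia.
  move: excl; rewrite nall_p -eq_w /=; lia.
have excl : ~~ allowed p ->
    ~~ (~~ late (fst_idx p) && ~~ early (snd_idx p))
    && ~~ (~~ late (snd_idx p) && ~~ early (fst_idx p)).
  by rewrite /allowed; case: (late _); case: (late _); case: (early _); case: (early _).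
rewrite g_minor_mon => q /msuppB_le; rewrite mem_cat !msuppX !inE.
case/orP => /eqP->; first by apply: le_t => //; apply/implyP => /excl /andP[].
by rewrite [W (fst_idx p) + _]addnC; apply: le_t => //; apply/implyP => /excl /andP[].
Qed.

Lemma fiber_Pi_mon (m : mon) : fiber_Pi ('X_[m] : {mpoly K[fiber_nvars n]})
  = (\prod_(p : incr 2 c) g_minor K (fst_idx p) (snd_idx p) ^+ m (enum_rank p))%R.
Proof.
rewrite /fiber_Pi comp_mpolyX (reindex _ (onW_bij _ (@enum_rank_bij _))).
by apply: eq_bigr => p _; rewrite tnth_mktuple enum_rankK.
Qed.

Lemma fiber_Pi_mon_degree (m : mon) :
  fiber_Pi ('X_[m] : {mpoly K[fiber_nvars n]}) \is (2 * mdeg m).-homog.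
Proof.
rewrite fiber_Pi_mon mdeg_pairs big_distrr /=.
apply: (big_ind2 (fun f t => f \is t.-homog)) => [|f l g k|p _].
- exact: dhomog1.
- exact: dhomogM.
by apply: dhomogMn; rewrite g_minor_mon rpredB // dhomogX /= mdegD !mdeg1.
Qed.

(** A factor that is not allowed loses weight, by the strict cases of
    [top_weight] and [bot_weight]. *)
Lemma fiber_Pi_mon_weight (m : mon) q :
  q \in msupp (fiber_Pi ('X_[m] : {mpoly K[fiber_nvars n]})) ->
  mon_weight v q + ~~ mon_allowed m <= column_degree m + mdeg m * M.
Proof.
move=> q_supp; rewrite -column_degree_shift.
have le_q : mon_weight v q <= \sum_(p : incr 2 c)
    m (enum_rank p) * (W (fst_idx p) + W (snd_idx p) + M - ~~ allowed p).
  move: q q_supp; rewrite fiber_Pi_mon.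
  apply: (big_ind2 (fun f t => weight_at_most v f t)) => [|f l g k|p _].
  - exact: weight_at_most1.
  - exact: weight_at_mostM.
  by apply: weight_at_mostX; apply: g_minor_weight.
have [_|] := boolP (mon_allowed m).
  rewrite addn0; apply: leq_trans le_q _; apply: leq_sum => p _.
  by rewrite leq_mul2l leq_subr orbT.
rewrite negb_forall => /existsP[p0]; rewrite negb_imply => /andP[m_p0 not_p0].
rewrite addn1; apply: leq_ltn_trans le_q _.
rewrite (bigD1 p0) //= [X in _ < X](bigD1 p0) //= not_p0 -addSn leq_add //.
  rewrite ltn_mul2l m_p0 /=.
  by have := column_weight_gt0 (fst_idx p0); lia.
by apply: leq_sum => p _; rewrite leq_mul2l leq_subr orbT.
Qed.

End Minors.

(** A column order refining the degeneration: the columns before [h] from left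
    to right, then the others from right to left. *)
Variable h : nat.
Hypothesis late_h : forall u, late u -> h <= u.
Hypothesis late_initial : forall u v, h <= u -> u < v -> late v -> late u.
Hypothesis early_h : forall u, u < c -> early u -> u < h.

Definition spread (u : nat) : nat := if u < h then u else h + (c - u).

(** Chosen so that bottom minus top is [spread u] in the column [u]. *)
Definition perturbation (i : 'I_d) (j : nat) : nat :=
  \sum_(l < j) spread (column_index (i, nat_of_ord l)).

Lemma perturbation_bot u : u < c ->
  perturbation (column u).1 (column u).2.+1
  = perturbation (column u).1 (column u).2 + spread u.
Proof.
move=> lt_u; rewrite /perturbation big_ord_recr /=.
by rewrite -surjective_pairing columnK.
Qed.

Local Notation op p := (opener fst_col snd_col h p).
Local Notation cl p := (closer fst_col snd_col h p).

Section Pair.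

Variable p : incr 2 c.

Let lt_p : fst_idx p < snd_idx p := fst_lt_snd p.
Let lt_f : fst_idx p < c := ltn_ord _.
Let lt_s : snd_idx p < c := ltn_ord _.

Lemma opener_lt : op p < c. Proof. by rewrite /opener; case: ifP. Qed.
Lemma closer_lt : cl p < c. Proof. by rewrite /closer; case: ifP. Qed.

Lemma spread_lt : spread (op p) < spread (cl p).
Proof.
rewrite /opener /closer /spread; case: (leqP h (fst_idx p)) => h_f.
  by rewrite !ltnNge (leq_trans h_f (ltnW lt_p)) h_f /=; lia.
by rewrite h_f; case: ifP; lia.
Qed.

Lemma opener_not_late : allowed p -> ~~ late (op p).
Proof.
rewrite /allowed /opener => /andP[_]; apply: contra.
case: (leqP h (fst_idx p)) => [h_f late_s|h_f /late_h]; last by lia.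
by rewrite late_s andbT; apply: late_initial late_s.
Qed.

Lemma closer_not_early : allowed p -> ~~ early (cl p).
Proof.
rewrite /allowed /closer => /andP[+ _]; apply: contra.
case: (leqP h (fst_idx p)) => [h_f /early_h|h_f early_s]; first by lia.
by rewrite early_s andbT; move: early_s; rewrite /early; lia.
Qed.

Definition pair_lead := (U_(x_top (op p)) + U_(x_bot (cl p)))%MM.
Definition pair_other := (U_(x_top (cl p)) + U_(x_bot (op p)))%MM.

Local Notation w := (on_x perturbation).

Lemma opener_closer_weight : W (op p) + W (cl p) = W (fst_idx p) + W (snd_idx p).
Proof. by rewrite /opener /closer; case: ifP; lia. Qed.

Lemma pair_lead_weight : allowed p ->
  mon_weight v pair_lead = W (fst_idx p) + W (snd_idx p) + M.
Proof.
move=> all_p; have [_] := entry_weight_pair opener_lt closer_lt.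
rewrite opener_not_late // closer_not_early // => /eqP eq_w.
by rewrite -opener_closer_weight /pair_lead eq_w; lia.
Qed.

Lemma pair_other_lt : allowed p -> weight_lt v w pair_other pair_lead.
Proof.
move=> all_p; rewrite /weight_lt pair_lead_weight // -opener_closer_weight.
have [le_other _] := entry_weight_pair closer_lt opener_lt.
suff : mon_weight w pair_other < mon_weight w pair_lead.
  by move: le_other; rewrite -/pair_other; lia.
rewrite !mon_weightD !mon_weightU !on_xE ?x_top_bound ?x_bot_bound ?opener_lt ?closer_lt //.
rewrite !perturbation_bot ?opener_lt ?closer_lt //.
by have := spread_lt; lia.
Qed.

Variable K : fieldType.

Lemma g_minor_pair : exists s : bool,
  g_minor K (fst_idx p) (snd_idx p)
  = (-1) ^+ s *: ('X_[pair_lead] - 'X_[pair_other])%R.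
Proof.
rewrite g_minor_mon /pair_lead /pair_other /opener /closer.
case: ifP => _; [exists true | exists false]; rewrite ?expr1 ?expr0 ?scale1r //.
by rewrite scaleN1r opprB.
Qed.

(** Both entries of the product [pair_lead] have the full weight that their
    columns allow; if [pair_other] does as well, the perturbation decides. *)
Lemma g_minor_lead : allowed p ->
  weight_lead v w (g_minor K (fst_idx p) (snd_idx p)) pair_lead.
Proof.
move=> all_p; have [s ->] := g_minor_pair.
exists ((-1) ^+ s)%R, (- ((-1) ^+ s *: 'X_[pair_other]))%R; split.
- by rewrite signr_eq0.
- by rewrite scalerBr.
move=> q; rewrite (perm_mem (msuppN _)) => /msuppZ_le; rewrite msuppX inE.
by move/eqP->; apply: pair_other_lt.
Qed.

End Pair.

Section Monomials.

Local Notation w := (on_x perturbation).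

Definition mon_lead (m : mon) :=
  (\big[mnm_add/0%MM]_(p : incr 2 c) (pair_lead p *+ m (enum_rank p))%MM).

Variable K : fieldType.

Lemma fiber_Pi_mon_lead (m : mon) : mon_allowed m ->
  weight_lead v w (fiber_Pi ('X_[m] : {mpoly K[fiber_nvars n]})) (mon_lead m).
Proof.
move=> /forallP all_m; rewrite fiber_Pi_mon /mon_lead.
apply: (big_ind2 (fun f l => weight_lead v w f l)) => [|f l g k|p _].
- exact: weight_lead1.
- exact: weight_leadM.
have := all_m p; case: (m _) => [_|e /= all_p].
  by rewrite expr0; apply: weight_lead1.
exact/weight_leadX/g_minor_lead.
Qed.

Lemma mon_lead_weight (m : mon) : mon_allowed m ->
  mon_weight v (mon_lead m) = column_degree m + mdeg m * M.
Proof.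
move=> /forallP all_m; rewrite -column_degree_shift /mon_lead.
apply: (big_ind2 (fun l t => mon_weight v l = t)) => [|l t k u <- <-|p _].
- exact: mon_weight0.
- exact: mon_weightD.
have := all_m p; elim: (m _) => [_|e IHe all_p]; first exact: mon_weight0.
rewrite mulmS mon_weightD mulSn IHe; last by apply/implyP => _; apply: all_p.
by rewrite pair_lead_weight //; apply: all_p.
Qed.

Section Recover.

Variable m : mon.

Definition openers u := \sum_(p : incr 2 c | op p == u) m (enum_rank p).
Definition closers u := \sum_(p : incr 2 c | cl p == u) m (enum_rank p).

Lemma mon_leadE q : mon_lead m q =
  \sum_(p : incr 2 c | x_top (op p) == q) m (enum_rank p)
  + \sum_(p : incr 2 c | x_bot (cl p) == q) m (enum_rank p).
Proof.
rewrite /mon_lead mnm_sumE !(big_mkcond (fun p => _ == q)) -big_split /=.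
apply: eq_bigr => p _; rewrite mulmnE mnmDE !mnm1E.
by case: eqP; case: eqP => _ _; lia.
Qed.

Lemma mon_lead_bot u : u < c ->
  mon_lead m (x_bot u) = (if u < c - d then openers (next_column u) else 0) + closers u.
Proof.
move=> lt_u; rewrite mon_leadE; congr (_ + _); last first.
  by apply: eq_bigl => p; rewrite x_bot_eq ?closer_lt.
under eq_bigl => p do rewrite x_top_bot_eq ?opener_lt //.
by case: ifP => //= _; rewrite big_pred0.
Qed.

Lemma mon_lead_top u : u < c -> (column u).2 = 0 -> mon_lead m (x_top u) = openers u.
Proof.
move=> lt_u u0; rewrite mon_leadE [X in _ + X]big_pred0 ?addn0.
  by apply: eq_bigl => p; rewrite x_top_eq ?opener_lt.
move=> p; rewrite eq_sym x_top_bot_eq ?closer_lt //.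
apply/negP => /andP[lt_p /eqP eq_u]; move: u0.
by rewrite eq_u column_next.
Qed.

Hypothesis all_m : mon_allowed m.

Let exp_allowed p : 0 < m (enum_rank p) -> allowed p.
Proof. by move: all_m => /forallP/(_ p)/implyP. Qed.

Lemma openers_late u : late u -> openers u = 0.
Proof.
move=> late_u; apply: big1 => p /eqP op_u; apply/eqP; rewrite -leqn0 leqNgt.
by apply/negP => /exp_allowed/opener_not_late; rewrite op_u late_u.
Qed.

Lemma closers_early u : early u -> closers u = 0.
Proof.
move=> early_u; apply: big1 => p /eqP cl_u; apply/eqP; rewrite -leqn0 leqNgt.
by apply/negP => /exp_allowed/closer_not_early; rewrite cl_u early_u.
Qed.

Lemma closers_sum : \sum_(u < c) closers u = mdeg m.
Proof.
rewrite mdeg_pairs; under eq_bigr do rewrite /closers big_mkcond.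
rewrite exchange_big; apply: eq_bigr => p _ /=.
rewrite (bigD1 (Ordinal (closer_lt p))) //= eqxx big1 ?addn0 // => u ne_u.
by rewrite eq_sym ifN.
Qed.

End Recover.

Lemma openers_out m u : c <= u -> openers m u = 0.
Proof. by move=> le_u; rewrite /openers big_pred0 // => p; have := opener_lt p; lia. Qed.

Lemma closers_out m u : c <= u -> closers m u = 0.
Proof. by move=> le_u; rewrite /closers big_pred0 // => p; have := closer_lt p; lia. Qed.

(** A monomial of [R] does not tell whether the entry shared by the columns [B]
    and [next B] was contributed by a closer of the former or by an opener of
    the latter; the degree does. *)
Lemma mon_lead_closers m m' : mon_allowed m -> mon_allowed m' ->
  mdeg m = mdeg m' -> mon_lead m = mon_lead m' -> closers m =1 closers m'.
Proof.
move=> all_m all_m' eq_deg eq_lead.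
have eq_other u : u != B -> closers m u = closers m' u.
  move=> ne_uB; have [lt_u|le_u] := ltnP u c; last by rewrite !closers_out.
  have [early_u|] := boolP (early u); first by rewrite !closers_early.
  rewrite /early negb_and => early_u.
  have := mon_lead_bot m lt_u; rewrite eq_lead (mon_lead_bot m' lt_u).
  case: ifP => [lt_u'|_]; last by rewrite !add0n.
  have late_u : late (next_column u).
    by apply/lateP; exists u => //; move: ne_uB early_u; rewrite lt_u' orbF; lia.
  by rewrite !openers_late.
move=> u; have [->|/eq_other //] := eqVneq u B.
have [lt_B|le_B] := ltnP B c; last by rewrite !closers_out.
have := closers_sum m; rewrite eq_deg -closers_sum.
rewrite (bigD1 (Ordinal lt_B)) //= [X in _ = X -> _](bigD1 (Ordinal lt_B)) //=.
by rewrite (eq_bigr (fun u : 'I_c => closers m' u)) => [|i /eq_other //]; lia.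
Qed.

(** Every entry of the matrix that is not a bottom entry is the top of a first
    column in its block, where only openers contribute. *)
Lemma mon_lead_openers m m' : closers m =1 closers m' ->
  mon_lead m = mon_lead m' -> openers m =1 openers m'.
Proof.
move=> eq_cl eq_lead u; have [lt_u|le_u] := ltnP u c; last by rewrite !openers_out.
have [u0|u_gt0] := posnP (column u).2.
  by rewrite -!mon_lead_top // eq_lead.
have [a lt_a [<- _]] := column_next_exists n_gt0 lt_u u_gt0.
have lt_ac : a < c by lia.
have := mon_lead_bot m lt_ac; rewrite eq_lead (mon_lead_bot m' lt_ac) lt_a eq_cl.
by move/addIn.
Qed.

Definition noncrossing (m : mon) := forall p q : incr 2 c,
  0 < m (enum_rank p) -> 0 < m (enum_rank q) -> ~~ crossing fst_col snd_col p q.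

Lemma mon_lead_inj (m m' : mon) : mon_allowed m -> mon_allowed m' ->
  noncrossing m -> noncrossing m' -> mdeg m = mdeg m' ->
  mon_lead m = mon_lead m' -> m = m'.
Proof.
move=> all_m all_m' nc nc' eq_deg eq_lead.
have eq_cl := mon_lead_closers all_m all_m' eq_deg eq_lead.
have eq_op := mon_lead_openers eq_cl eq_lead.
have eq_m : (fun p : incr 2 c => m (enum_rank p)) =1 (fun p => m' (enum_rank p)).
  apply: (@noncrossing_matching_unique _ fst_col snd_col h) => //.
  - by move=> p; apply: fst_lt_snd.
  - by move=> p q /val_inj eq_f /val_inj eq_s; apply: incr2_eq.
by apply/mnmP => i; rewrite -[i]enum_valK; apply: eq_m.
Qed.

End Monomials.

End Degeneration.

(** * Independence of the standard monomials *)

Section Independence.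

Variables (K : fieldType) (d : nat) (n : 'I_d -> nat).
Hypotheses (d_gt0 : (0 < d)%N) (n_gt0 : forall i, (0 < n i)%N).
Hypothesis n_homo : forall i j : 'I_d, (i <= j)%N -> (n i <= n j)%N.

Local Notation c := (scroll_c n).
Local Notation mon := 'X_{1..fiber_nvars n}.
Local Notation S := {mpoly K[fiber_nvars n]}.

Lemma exists_max_seq (T : eqType) (s : seq T) (f : T -> nat) x : x \in s ->
  exists2 y, y \in s & forall z, z \in s -> (f z <= f y)%N.
Proof.
elim: s x => // a s IHs _ _; case: s IHs => [|b s] IHs.
  by exists a; rewrite ?mem_head // => z; rewrite inE => /eqP->.
have [y ys max_y] := IHs b (mem_head _ _); have [le_ay|lt_ya] := leqP (f a) (f y).
  exists y; first by rewrite inE ys orbT.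
  by move=> z; rewrite inE => /orP[/eqP->|/max_y].
exists a; first exact: mem_head.
move=> z; rewrite inE => /orP[/eqP-> //|/max_y le_zy].
exact: leq_trans le_zy (ltnW lt_ya).
Qed.

(** The least right end of an arc of a standard monomial is a cut [B] for which
    the monomial survives: the arc ending there forbids late pairs. *)
Lemma standard_allowed (m : mon) : standard (@gen_lead d n) m ->
  exists B, mon_allowed d_gt0 B m.
Proof.
move=> std_m; have [p0 m_p0|m0] := pickP (fun p : incr 2 c => 0 < m (enum_rank p))%N;
  last first.
  by exists 0%N; apply/forallP => p; rewrite m0.
case: (arg_minnP (P := fun p : incr 2 c => 0 < m (enum_rank p))%N
  (fun p => nat_of_ord (snd_idx p)) m_p0) => p1 m_p1 min_p1.
exists (nat_of_ord (snd_idx p1)); apply/forallP => p; apply/implyP => m_p.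
apply/andP; split; apply/negP => /andP[].
  by move=> _ /andP[]; have := min_p1 _ m_p; lia.
move=> /lateP[a lt_a eq_a] /lateP[b lt_b eq_b].
by apply: (standard_gap n_gt0 std_m m_p1 m_p lt_a lt_b (esym eq_a) (esym eq_b)).
Qed.

(** In a relation of standard monomials, [m0] has the largest column weight among
    those of its degree, [B] is a cut for which [m0] survives, and [m1] has the
    largest leading monomial among those that survive with the same weight.  No
    other term of the relation contains the leading monomial [l] of [m1]. *)
Lemma standard_independent (f : S) : fiber_ideal n K f ->
  (forall m, m \in msupp f -> standard (@gen_lead d n) m) -> f = 0.
Proof.
rewrite /fiber_ideal => f_ker std_f; apply/eqP; rewrite -msupp_eq0.
case def_s: (msupp f) => [//|ma s]; exfalso.
have {s def_s} ma_f : ma \in msupp f by rewrite def_s mem_head.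
pose r := mdeg ma.
have ma_r : ma \in [seq m <- msupp f | mdeg m == r] by rewrite mem_filter ma_f eqxx.
have [m0] := exists_max_seq (column_degree (n := n)) ma_r.
rewrite mem_filter => /andP[/eqP deg0 m0_f] max0.
have [B all0] := standard_allowed (std_f _ m0_f).
have [h [late_h late_init early_h]] := late_bound d_gt0 n_gt0 n_homo B.
pose same (m : mon) := [&& mdeg m == r, mon_allowed d_gt0 B m
                 & column_degree m == column_degree m0].
have m0_s : m0 \in [seq m <- msupp f | same m].
  by rewrite mem_filter m0_f /same deg0 all0 !eqxx.
pose w := @on_x d n (perturbation n h).
have [m1] := exists_max_seq (fun m => mon_weight w (mon_lead d_gt0 h m)) m0_s.
rewrite mem_filter => /andP[/and3P[/eqP deg1 all1 /eqP col1] m1_f] max1.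
pose l := mon_lead d_gt0 h m1.
have : (fiber_Pi f)@_l = 0 by rewrite f_ker mcoeff0.
have -> : fiber_Pi f = \sum_(m <- msupp f) f@_m *: fiber_Pi ('X_[m] : S).
  by rewrite {1}/fiber_Pi comp_mpolyEX; apply: eq_bigr => m _; rewrite /fiber_Pi comp_mpolyX.
rewrite raddf_sum /=; under eq_bigr => m _ do rewrite mcoeffZ.
rewrite (bigD1_seq m1) ?msupp_uniq //= big_seq_cond big1 ?addr0.
  move/eqP; apply/negP; rewrite mulf_eq0 negb_or -mcoeff_msupp m1_f /=.
  apply: weight_lead_coeff.
  exact: (fiber_Pi_mon_lead n_gt0 late_h late_init early_h K all1).
move=> m /andP[m_f ne_m].
rewrite [X in _ * X]memN_msupp_eq0 ?mulr0 //; apply/negP => l_m.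
case/eqP: ne_m.
have deg_l : mdeg l = (2 * r)%N.
  rewrite -deg1; apply: (dhomog_mf (fiber_Pi_mon_degree d_gt0 n_gt0 K m1)).
  rewrite mcoeff_msupp; apply: weight_lead_coeff.
  exact: (fiber_Pi_mon_lead n_gt0 late_h late_init early_h K all1).
have deg_m : mdeg m = r.
  have : mdeg l = (2 * mdeg m)%N.
    by apply: (dhomog_mf (fiber_Pi_mon_degree d_gt0 n_gt0 K m)).
  by rewrite deg_l; lia.
have le_m0 : (column_degree m <= column_degree m0)%N.
  by apply: max0; rewrite mem_filter deg_m eqxx.
have wt_l := mon_lead_weight n_gt0 late_h late_init early_h all1.
have := fiber_Pi_mon_weight d_gt0 n_gt0 B l_m.
rewrite wt_l deg1 deg_m col1.
have [all_m|] := boolP (mon_allowed d_gt0 B m); last by rewrite /=; lia.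
rewrite addn0 leq_add2r => ge_m0.
have col_m : column_degree m = column_degree m0 by lia.
have m_s : m \in [seq m <- msupp f | same m].
  by rewrite mem_filter m_f /same deg_m all_m col_m !eqxx.
have lead_m := fiber_Pi_mon_lead n_gt0 late_h late_init early_h K all_m.
have nc m' : m' \in msupp f -> noncrossing m'.
  by move=> /std_f std_m' p q; apply: standard_noncrossing.
have wt_m := mon_lead_weight n_gt0 late_h late_init early_h all_m.
have [eq_l|] := weight_lead_msupp lead_m l_m.
  apply/esym/(mon_lead_inj n_gt0 late_h late_init early_h) => //; try exact: nc.
  by rewrite deg1.
rewrite /weight_lt wt_l wt_m deg1 deg_m col1 col_m ltnn eqxx /=.
by rewrite ltnNge max1.
Qed.

End Independence.

(** * The Groebner basis *)

Section FiberIdeal.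

Variables (K : fieldType) (d : nat) (n : 'I_d -> nat).

Lemma fiber_ideal0 : fiber_ideal n K 0.
Proof. exact: comp_mpoly0. Qed.

Lemma fiber_idealD f g :
  fiber_ideal n K f -> fiber_ideal n K g -> fiber_ideal n K (f + g).
Proof.
by rewrite /fiber_ideal /fiber_Pi comp_mpolyD => -> ->; rewrite addr0.
Qed.

Lemma fiber_idealM h f : fiber_ideal n K f -> fiber_ideal n K (h * f).
Proof. by rewrite /fiber_ideal /fiber_Pi rmorphM /= => ->; rewrite mulr0. Qed.

End FiberIdeal.

Theorem theorem3p13 (K : fieldType) (d : nat) (n : 'I_d -> nat)
    (d_gt0 : (0 < d)%N) (n_gt0 : forall i, (0 < n i)%N)
    (n_homo : forall i j : 'I_d, (i <= j)%N -> (n i <= n j)%N) :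
  minimally_generates (fiber_gens n K) (fiber_ideal n K) /\
  squarefree_quadratic_groebner_basis (fiber_lt n)
    (family_pred (fiber_gens n K)) (fiber_ideal n K).
Proof.
pose J : finType := (incr 4 (scroll_c n) + incr 4 (scroll_c n - d))%type.
have ltO := fiber_term_order n.
have leadF := fiber_gens_lead K d_gt0 n_gt0.
have homF := fiber_gens_homog K (n := n).
have in_ideal := fiber_gens_in_ideal K d_gt0 n_gt0.
have indep := @standard_independent K d n d_gt0 n_gt0 n_homo.
split; split.
- exact (ideal_gen_of_standard (J := J) ltO leadF homF (fiber_ideal0 K n)
    (@fiber_idealD K d n) (@fiber_idealM K d n) in_ideal indep).
- exact (irredundant_of_distinct_leads (J := J) ltO leadF homF (gen_lead_inj d_gt0 n_gt0)).
- exact (groebner_of_standard (J := J) ltO leadF homF (fiber_ideal0 K n)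
    (@fiber_idealD K d n) (@fiber_idealM K d n) in_ideal indep).
move=> _ [t ->]; split; first exact: homF.
by exists (gen_lead t) => //; apply: (gen_lead_squarefree d_gt0 n_gt0).
Qed.
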